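(* Let $g:=\mathbf{1}_{[0,1/2)}-\mathbf{1}_{[1/2,1)}$ on $X=[0,1)$ and let $p\in(0,1)$. For $\mu_p$-almost every $x\in X$ there exists a sequence $(\ell_n)$ of positive integers such that $$\varphi^g_{x,\ell_n}\ \longrightarrow\ \frac{\mathcal{M}_p}{\|\mathcal{M}_p\|_\infty}\qquad\text{in }L^\infty([0,1])\text{ as }n\to\infty .$$
   Context: Pascal-adic transformation $T$ on $X=[0,1)$ (cutting and stacking). At stage $n\ge1$ there are $n+1$ towers $\tau_{n,0},\dots,\tau_{n,n}$; $\tau_{n,k}$ is an ordered (bottom to top) list of $\binom nk$ disjoint intervals (''rungs'') of the form $[\cdot,\cdot)$ and length $2^{-n}$, and $T$ maps each rung except the top one by translation onto the rung just above it. Start: $\tau_{1,0}$ has the single rung $[0,1/2)$ and $\tau_{1,1}$ the single rung $[1/2,1)$. From stage $n$ to $n+1$: cut each tower into its left-half and right-half sub-columns, and for $0\le k\le n-1$ define $T$ on the right half of the top rung of $\tau_{n,k}$ as the translation onto the left half of the base (bottom rung) of $\tau_{n,k+1}$. Thus $\tau_{n+1,0}$ is the left half of $\tau_{n,0}$, $\tau_{n+1,n+1}$ is the right half of $\tau_{n,n}$, and for $1\le k\le n$, $\tau_{n+1,k}$ is the right half of $\tau_{n,k-1}$ with the left half of $\tau_{n,k}$ stacked on top of it. Iterating defines $T$ on $X$ minus a countable set. For $0<p<1$, $\mu_p$ is the $T$-invariant ergodic probability measure on $[0,1)$ which is the image of the Bernoulli product measure on $\{0,1\}^{\mathbb{N}}$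 giving each coordinate the value $0$ with probability $1-p$ and $1$ with probability $p$, under the map $(x_k)_{k\ge1}\mapsto\sum_{k\ge1}x_k2^{-k}$. For a real function $g$ on $X$, a point $x$ and an integer $\ell\ge1$ such that $x,Tx,\dots,T^{\ell-1}x$ are defined, $F^g_{x,\ell}:[0,\ell]\to\mathbb{R}$ is given by $F^g_{x,\ell}(0)=0$, $F^g_{x,\ell}(j)=\sum_{i=0}^{j-1}g(T^ix)$ for integers $1\le j\le\ell$, and linear interpolation between integers. Put $R^g_{x,\ell}:=\max_{0\le t\le1}|F^g_{x,\ell}(t\ell)-tF^g_{x,\ell}(\ell)|$ if this is nonzero, and $R^g_{x,\ell}:=1$ otherwise, and $$\varphi^g_{x,\ell}(t):=\frac{F^g_{x,\ell}(t\ell)-tF^g_{x,\ell}(\ell)}{R^g_{x,\ell}},\qquad t\in[0,1].$$ For $0<p<1$, let $\alpha_p^L(x,y):=(px,\,py+x)$ and $\alpha_p^R(x,y):=\bigl((1-p)x+p,\,(1-p)y-x+1\bigr)$, affine maps of $[0,1]\times\mathbb{R}$ to itself. There is a unique nonempty compact set $E_p\subset[0,1]\times\mathbb{R}$ with $E_p=\alpha_p^L(E_p)\cup\alpha_p^R(E_p)$, and $E_p$ is the graph of a continuous function $\mathcal{M}_p:[0,1]\to\mathbb{R}$; this defines $\mathcal{M}_p$. *)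

(* Defs.v *)
From mathcomp Require Import all_boot all_order all_algebra.
From mathcomp Require Import all_classical all_reals all_analysis.
From HB Require Import structures.
From mathcomp Require Import measurable_realfun.
From mathcomp Require Import ring lra.

Set Implicit Arguments.
Unset Strict Implicit.
Unset Printing Implicit Defensive.

Import Order.TTheory GRing.Theory Num.Theory.
Import numFieldNormedType.Exports.

Local Open Scope classical_set_scope.
Local Open Scope ring_scope.

Section pascal_adic.
Context {R : realType}.

(* [tower n k], for 1 <= n and k <= n, lists the left endpoints of the rungs of
   the tower tau_{n,k} from bottom to top, a rung being [a, a + 2^-n[. The left
   half of a rung keeps its left endpoint, so that only right halves have to be
   translated. The values outside of 1 <= n, k <= n are empty lists. *)
Fixpoint tower (n k : nat) : seq R :=
  match n with
  | 0 => [::]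
  | 1 => match k with 0 => [:: 0] | 1 => [:: 2^-1] | _ => [::] end
  | (_.+1 as m).+1 =>
    (if k is j.+1 then [seq a + 2 ^- m.+1 | a <- tower m j] else [::])
      ++ tower m k
  end.

(* y = T x *)
Definition pascal_graph (x y : R) : Prop :=
  exists n k i : nat,
    [/\ (1 <= n)%N, (k <= n)%N, (i.+1 < size (tower n k))%N,
        (tower n k)`_i <= x < (tower n k)`_i + 2 ^- n
      & y = x - (tower n k)`_i + (tower n k)`_i.+1].

Definition pascal_dom : set R := [set x | exists y, pascal_graph x y].

(* meaningful on [pascal_dom] only *)
Definition pascalT (x : R) : R := get (pascal_graph x).

(* x, T x, ..., T^(l-1) x are all defined *)
Definition orbit_defined (x : R) (l : nat) : Prop :=
  forall i, (i.+1 < l)%N -> pascal_dom (iter i pascalT x).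

Section ergodic_sums.
Variables (g : R -> R) (x : R).

Definition ergodic_sum (j : nat) : R := \sum_(i < j) g (iter i pascalT x).

(* F^g_{x,l}(t) for 0 <= t <= l; it depends on l only through its domain. At an
   integer t the coefficient of the increment vanishes, so that F^g_{x,l}(l)
   only involves x, ..., T^(l-1) x. *)
Definition ergodic_interp (t : R) : R :=
  let j := Num.truncn t in
  ergodic_sum j + (t - j%:R) * (ergodic_sum j.+1 - ergodic_sum j).

Definition ergodic_dev (l : nat) (t : R) : R :=
  ergodic_interp (t * l%:R) - t * ergodic_interp l%:R.

(* The supremum is a maximum, [ergodic_dev l] being continuous. *)
Definition ergodic_scale (l : nat) : R :=
  let r := sup [set `|ergodic_dev l t| | t in `[0, 1]] in
  if r != 0 then r else 1.

Definition ergodic_phi (l : nat) (t : R) : R :=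
  ergodic_dev l t / ergodic_scale l.

End ergodic_sums.

Definition g_half (x : R) : R := \1_(`[0, 2^-1[) x - \1_(`[2^-1, 1[) x.

End pascal_adic.

(* These sets generate the product sigma-algebra on {0,1}^N. Coordinates are
   numbered from 0, so that [w k] is the binary digit of weight 2^-(k+1). *)
Definition coordinate_sets : set (set (nat -> bool)) :=
  [set A | exists (k : nat) (b : bool), A = [set w | w k = b]].

Definition bin_seq := g_sigma_algebraType coordinate_sets.

Section bernoulli_measure.
Context {R : realType}.
Implicit Types p : R.

(* [bernoulli_pmf p true = p] and [bernoulli_pmf p false = 1 - p] *)
Definition is_bernoulli_product p (P : probability bin_seq R) : Prop :=
  forall (n : nat) (w : nat -> bool),
    P [set x | forall i, (i < n)%N -> x i = w i] =
    (\prod_(i < n) bernoulli_pmf p (w i))%:E.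

Definition bernoulli_product p : probability bin_seq R :=
  get (is_bernoulli_product p).

Definition bin_value (w : bin_seq) : R :=
  limn (series (fun k => (w k)%:R / 2 ^+ k.+1 : R)).

Lemma measurable_coordinate (k : nat) :
  measurable_fun [set: bin_seq] (fun w : bin_seq => w k).
Proof.
apply: (measurable_fun_bool true) => //; rewrite setTI.
by apply: sub_sigma_algebra; exists k, true; apply/seteqP; split.
Qed.

Lemma cvg_bin_value (w : bin_seq) :
  cvgn (series (fun k => (w k)%:R / 2 ^+ k.+1 : R)).
Proof.
apply: (@series_le_cvg _ _ (geometric (2^-1) (2^-1))).
- by move=> k; rewrite divr_ge0// exprn_ge0.
- by move=> k; rewrite /geometric/= mulr_ge0// ?exprn_ge0// invr_ge0.
- move=> k; rewrite /geometric/= exprS invfM -exprVn ler_piMl//.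
  by case: (w k).
- by apply: is_cvg_geometric_series; rewrite gtr0_norm ?invf_lt1 ?ltr1n.
Qed.

Lemma measurable_bin_value : measurable_fun [set: bin_seq] bin_value.
Proof.
apply: (measurable_fun_cvg
  (h := fun n (w : bin_seq) => series (fun k => (w k)%:R / 2 ^+ k.+1 : R) n)).
  move=> n; apply: measurable_sum => k; apply: measurable_funM => //.
  rewrite [X in measurable_fun _ X](_ : _ =
    (fun w : bin_seq => if w k then 1 else 0 : R)); last first.
    by apply/funext => w; case: (w k).
  by apply: measurable_fun_ifT => //; exact: measurable_coordinate.
by move=> w _; exact: cvg_bin_value.
Qed.

HB.instance Definition _ :=
  isMeasurableFun.Build _ _ _ _ bin_value measurable_bin_value.

(* the image of the Bernoulli product measure, as a probability on the real line
   carried by [0, 1] *)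
Definition pascal_mu p : probability R R :=
  distribution (bernoulli_product p) bin_value.

(* [bernoulli_product p] is not a default value when 0 < p < 1: the coding
   of the uniform law by the map [coding_shift] satisfies its specification. *)
Section bernoulli_product_exists.
Variable p : R.

Definition coding_digit (u : R) : bool := 1 - p <= u.
Definition coding_shift (u : R) : R :=
  if coding_digit u then (u - (1 - p)) / p else u / (1 - p).
Definition coding (u : measurableTypeR R) : bin_seq :=
  fun n => coding_digit (iter n coding_shift u).

Let mdigit : measurable_fun [set: R] coding_digit.
Proof. exact: measurable_fun_ler. Qed.

Let mshift : measurable_fun [set: R] coding_shift.
Proof.
apply: measurable_fun_ifT => //.
  apply: measurable_funM => //; exact: measurable_funB.
exact: measurable_funM.
Qed.

Let miter n : measurable_fun [set: R] (iter n coding_shift).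
Proof.
elim: n => [|n IH]; first exact: measurable_id.
exact: (measurableT_comp mshift IH).
Qed.

Let mcoding : measurable_fun [set: measurableTypeR R] coding.
Proof.
apply: (@measurability _ _ _ bin_seq setT coding coordinate_sets) => //
  _ [_ [k [b ->]] <-].
rewrite setTI.
have := measurableT_comp mdigit (miter k).
move=> /(_ measurableT [set b]); rewrite setTI; apply.
by [].
Qed.

HB.instance Definition _ := isMeasurableFun.Build _ _ _ _ coding mcoding.

Let coding_cylinder (p01 : 0 < p < 1) (n : nat) (w : nat -> bool) :
  exists2 a : R, 0 <= a /\ a + \prod_(i < n) bernoulli_pmf p (w i) <= 1 &
  forall u : R, 0 <= u < 1 ->
    (forall i, (i < n)%N -> coding u i = w i) <->
    a <= u < a + \prod_(i < n) bernoulli_pmf p (w i).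
Proof.
have [p0 p1] := andP p01.
have q0 : 0 < 1 - p by lra.
elim: n w => [|n IH] w.
  exists 0; rewrite big_ord0; first by lra.
  by move=> u u01; split => //; lra.
have [a [a0 a1] aP] := IH (fun i => w i.+1).
rewrite big_ord_recl /=.
under eq_bigr do rewrite /bump /= add1n.
set c := \prod_(i < n) _ in a1 aP *.
exists (if w 0%N then (1 - p) + p * a else (1 - p) * a).
  rewrite /bernoulli_pmf; case: (w 0%N); nra.
move=> u u01.
have step : (forall i, (i < n.+1)%N -> coding u i = w i) <->
    coding_digit u = w 0%N /\
    (forall i, (i < n)%N -> coding (coding_shift u) i = w i.+1).
  split=> [H|[H0 H] [|i] ilt].
  - split; first exact: (H 0%N).
    by move=> i ilt; rewrite -(H i.+1)// /coding -iterSr.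
  - exact: H0.
  - by rewrite /coding iterSr; exact: H.
rewrite step /coding_digit /bernoulli_pmf.
case: (w 0%N) => /=.
- split.
  + move=> [du].
    have su : coding_shift u = (u - (1 - p)) / p.
      by rewrite /coding_shift /coding_digit du.
    have eu : u = 1 - p + p * coding_shift u.
      by rewrite su; field; rewrite gt_eqF.
    have s01 : 0 <= coding_shift u < 1.
      by rewrite su divr_ge0 ?subr_ge0 ?(ltW p0)// ltr_pdivrMr//; lra.
    move=> /(aP _ s01) H; nra.
  + move=> H.
    have du : 1 - p <= u by nra.
    split; first exact: du.
    have su : coding_shift u = (u - (1 - p)) / p.
      by rewrite /coding_shift /coding_digit du.
    have eu : u = 1 - p + p * coding_shift u.
      by rewrite su; field; rewrite gt_eqF.
    have s01 : 0 <= coding_shift u < 1.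
      by rewrite su divr_ge0 ?subr_ge0 ?(ltW p0)// ltr_pdivrMr//; lra.
    apply/(aP _ s01); nra.
- split.
  + move=> [du].
    have su : coding_shift u = u / (1 - p).
      by rewrite /coding_shift /coding_digit du.
    have eu : u = (1 - p) * coding_shift u by rewrite su; field; rewrite gt_eqF.
    have s01 : 0 <= coding_shift u < 1.
      rewrite su divr_ge0 ?(ltW q0)//; last by lra.
      by rewrite ltr_pdivrMr// mul1r ltNge du.
    move=> /(aP _ s01) H; nra.
  + move=> H.
    have ul : u < 1 - p by nra.
    have du : (1 - p <= u) = false by apply/negbTE; rewrite -ltNge.
    split; first exact: du.
    have su : coding_shift u = u / (1 - p).
      by rewrite /coding_shift /coding_digit du.
    have eu : u = (1 - p) * coding_shift u by rewrite su; field; rewrite gt_eqF.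
    have s01 : 0 <= coding_shift u < 1.
      rewrite su divr_ge0 ?(ltW q0)//; last by lra.
      by rewrite ltr_pdivrMr// mul1r.
    apply/(aP _ s01); nra.
Qed.

Let m01 : measurable (`[0, 1[ : set (measurableTypeR R)).
Proof. exact: measurable_itv. Qed.

Definition uniform_itvco : set (measurableTypeR R) -> \bar R :=
  mrestr lebesgue_measure m01.

HB.instance Definition _ := Measure.on uniform_itvco.

Let uniform_itvcoT : uniform_itvco setT = 1%E.
Proof.
rewrite /uniform_itvco /mrestr setTI lebesgue_measure_itv/= lte_fin ltr01.
by rewrite oppr0 adde0.
Qed.

HB.instance Definition _ :=
  Measure_isProbability.Build _ _ _ uniform_itvco uniform_itvcoT.

Lemma bernoulli_product_exists :
  0 < p < 1 -> exists P, is_bernoulli_product p P.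
Proof.
move=> p01; exists (distribution uniform_itvco coding) => n w.
rewrite /distribution /pushforward /= /uniform_itvco /mrestr.
have [a [a0 a1] aP] := coding_cylinder p01 n w.
rewrite [X in lebesgue_measure X](_ : _ =
  `[a, a + \prod_(i < n) bernoulli_pmf p (w i)[%classic).
  rewrite lebesgue_measure_itv/= lte_fin ltrDl.
  case: ifPn => [_|]; first by rewrite -EFinD addrC addKr.
  rewrite -leNgt => c0; congr EFin; apply/eqP; rewrite eq_le c0 andbT.
  apply: prodr_ge0 => i _; apply: bernoulli_pmf_ge0.
  by have /andP[/ltW -> /ltW ->] := p01.
apply/seteqP; split => u /=; rewrite !in_itv/=.
  by move=> [H u01]; apply/(aP u u01).
move=> H; have u01 : 0 <= u < 1 by lra.
by split=> //; apply/(aP u u01).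
Qed.

End bernoulli_product_exists.

End bernoulli_measure.

Section limit_curve.
Context {R : realType}.
Implicit Types (p : R) (z : R * R).

Definition alphaL p z : R * R := (p * z.1, p * z.2 + z.1).
Definition alphaR p z : R * R :=
  ((1 - p) * z.1 + p, (1 - p) * z.2 - z.1 + 1).

Definition is_attractor p (E : set (R * R)) : Prop :=
  [/\ E !=set0, compact E, E `<=` `[0, 1] `*` setT
    & E = alphaL p @` E `|` alphaR p @` E].

Definition attractor p : set (R * R) := get (is_attractor p).

(* the function on [0, 1] whose graph is [attractor p] *)
Definition limit_curve p (x : R) : R := get [set y | attractor p (x, y)].

End limit_curve.

Section Linfty_norm.
Context {R : realType}.

Definition lebesgue01 : set (measurableTypeR R) -> \bar R :=
  mrestr lebesgue_measure (measurable_itv `[0, 1]).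

HB.instance Definition _ := Measure.on lebesgue01.

(* the norm of L^oo([0, 1]) *)
Definition Linfty01 (f : R -> R) : \bar R :=
  'N[lebesgue01]_(+oo)[EFin \o f]%E.

End Linfty_norm.

(* Main.v *)
Require Import Defs.
From mathcomp Require Import all_boot all_order all_algebra.
From mathcomp Require Import all_classical all_reals all_analysis.
From mathcomp Require Import ess_sup_inf ring lra.
Import Order.TTheory GRing.Theory Num.Theory.
Import numFieldNormedType.Exports.
Local Open Scope classical_set_scope.
Local Open Scope ring_scope.

(** The word of a tower is the list of values of g along its rungs. A tower is
    the concatenation of two towers of the previous stage, hence so is its
    word, and the deviation D of the partial sums of the word from their chord
    inherits a self-affine recursion: with lambda = k / n the relative length
    of the lower part, D_{n,k} is on [0, lambda] a rescaled D_{n-1,k-1} plus a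
    linear ramp up to the height c_{n,k} = D_{n,k}(lambda), and on [lambda, 1]
    a rescaled D_{n-1,k} plus a ramp down ([word_dev_recl]). Explicitly
    c_{n,k} = 2 C(n,k) k (n - k) / (n^2 (n - 1)), so when k / n is near p the
    heights of the two parts are near p c_{n,k} and (1 - p) c_{n,k}. Up to
    small errors, D_{n,k} / c_{n,k} is thus the image of its two predecessors
    under the operator whose fixed point is the limit curve.

    That operator contracts by a factor close to max(p, 1 - p). Iterating it
    over a small proportion of the n levels keeps k / n near p and gains an
    exponential factor, which beats the crude bound D_{n,k} = O(n c_{n,k}) at
    the starting level. Hence D_{n,k} / c_{n,k} tends uniformly to the curve
    as n grows and k / n tends to p ([word_dev_limit]).

    The curve is the sum of the series [curve] of rescaled tents. The partial
    sums are Lipschitz and converge geometrically, which gives a modulus of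
    continuity; contraction shows that every attractor is the graph of this
    sum ([limit_curveE]).

    It remains to see, from almost every point x, nearly a full tower whose
    index satisfies k / n near p. The binary digits of x give its rung, and
    right halves go to the bottom: after a run of m digits 1 following the
    n-th digit, x sits in the lowest C(n,k) / C(n+m,k+m) = O(rho^m) part of
    its tower, for some rho < 1. Taking for l the number of rungs from x to the
    top, the deviation along the orbit is D with a negligible initial part cut
    off ([dev_close]). Runs of every length m, at places n where the number of
    1s among the first n digits is near p n, occur almost surely: among many
    disjoint blocks placed far out, the weak law controls all the frequencies
    at once and independence provides a run ([long_run_frequent]). *)

(** * The limit curve as a self-affine series *)

Section curve.
Context {R : realType}.
Variable p : R.
Hypotheses (p0 : 0 < p) (p1 : p < 1).

(** The tent with value 1 at p that vanishes off [0, 1]; because of this the two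
    self-affine branches of the curve can be added without case distinction. *)
Definition tent (x : R) : R := Num.max 0 (Num.min (x / p) ((1 - x) / (1 - p))).

Fixpoint curve_term (i : nat) (x : R) : R :=
  if i is j.+1 then
    p * curve_term j (x / p) + (1 - p) * curve_term j ((x - p) / (1 - p))
  else tent x.

Definition curve (x : R) : R := limn (series (fun i => curve_term i x)).

(** The contraction factor of the pair of affine maps. *)
Definition rate : R := Num.max p (1 - p).

Let q0 : 0 < 1 - p. Proof. by rewrite subr_gt0. Qed.

Lemma rate_gt0 : 0 < rate.
Proof. by rewrite /rate lt_max p0. Qed.

Lemma rate_lt1 : rate < 1.
Proof. by rewrite /rate gt_max p1 /= ltrBlDr ltrDl. Qed.

Let r0 := rate_gt0.
Let r1 := rate_lt1.

Lemma rate_ge : p <= rate /\ 1 - p <= rate.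
Proof. by rewrite /rate !le_max !lexx orbT. Qed.

Let left_le0 (x : R) : x <= 0 -> x / p <= 0.
Proof. by move=> x0; rewrite ler_pdivrMr// mul0r. Qed.
Let left_ge1 (x : R) : p <= x -> 1 <= x / p.
Proof. by move=> x0; rewrite ler_pdivlMr// mul1r. Qed.
Let right_le0 (x : R) : x <= p -> (x - p) / (1 - p) <= 0.
Proof. by move=> x0; rewrite ler_pdivrMr// mul0r subr_le0. Qed.
Let right_ge1 (x : R) : 1 <= x -> 1 <= (x - p) / (1 - p).
Proof. by move=> x0; rewrite ler_pdivlMr// mul1r; lra. Qed.

Lemma tent_left (x : R) : 0 <= x <= p -> tent x = x / p.
Proof.
move=> /andP[x0 xp]; rewrite /tent min_l.
  by rewrite max_r// divr_ge0// ltW.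
apply: (@le_trans _ _ 1); first by rewrite ler_pdivrMr// mul1r.
by rewrite ler_pdivlMr// mul1r; lra.
Qed.

Lemma tent_right (x : R) : p <= x <= 1 -> tent x = (1 - x) / (1 - p).
Proof.
move=> /andP[xp x1]; rewrite /tent min_r.
  by rewrite max_r// divr_ge0 ?subr_ge0// ltW.
apply: (@le_trans _ _ 1); last by rewrite ler_pdivlMr// mul1r.
by rewrite ler_pdivrMr// mul1r; lra.
Qed.

Lemma tent_out (x : R) : (x <= 0) || (1 <= x) -> tent x = 0.
Proof.
rewrite /tent => h; apply: max_l; rewrite ge_min.
case/orP: h => [/left_le0 ->//|x1].
by rewrite [X in _ || X]ler_pdivrMr// mul0r subr_le0 x1 orbT.
Qed.

Lemma curve_term_out i (x : R) : (x <= 0) || (1 <= x) -> curve_term i x = 0.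
Proof.
elim: i x => [|i IH] x /=; first exact: tent_out.
move=> h; rewrite !IH ?mulr0 ?addr0//.
  case/orP: h => [x0|x1]; first by rewrite right_le0// (le_trans x0)// ltW.
  by rewrite right_ge1 ?orbT.
case/orP: h => [x0|x1]; first by rewrite left_le0.
by rewrite left_ge1 ?orbT// (le_trans _ x1)// ltW.
Qed.

Lemma curve_term_left i (x : R) : x <= p ->
  curve_term i.+1 x = p * curve_term i (x / p).
Proof.
by move=> xp; rewrite /= [X in _ + _ * X]curve_term_out ?right_le0// mulr0 addr0.
Qed.

Lemma curve_term_right i (x : R) : p <= x ->
  curve_term i.+1 x = (1 - p) * curve_term i ((x - p) / (1 - p)).
Proof.
by move=> xp; rewrite /= [X in _ * X + _]curve_term_out ?left_ge1 ?orbT// mulr0 add0r.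
Qed.

Lemma curve_term_bounds i (x : R) : 0 <= curve_term i x <= rate ^+ i.
Proof.
have [rp rq] := rate_ge.
elim: i x => [|i IH] x.
  rewrite expr0 /= /tent; apply/andP; split; first by rewrite le_max lexx.
  rewrite ge_max ler01/= ge_min.
  have [xp|px] := leP x p; first by rewrite ler_pdivrMr// mul1r xp.
  by apply/orP; right; rewrite ler_pdivrMr// mul1r; lra.
have [xp|px] := leP x p.
  rewrite curve_term_left// exprS; have /andP[a b] := IH (x / p).
  by rewrite mulr_ge0 ?(ltW p0)//= ler_pM ?(ltW p0).
rewrite curve_term_right ?(ltW px)// exprS.
have /andP[a b] := IH ((x - p) / (1 - p)).
by rewrite mulr_ge0 ?(ltW q0)//= ler_pM ?(ltW q0).
Qed.

Definition curve_lip : R := p^-1 + (1 - p)^-1.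

Let lip0 : 0 < curve_lip.
Proof. by rewrite addr_gt0// invr_gt0. Qed.

(* Two Lipschitz pieces that agree at a point glue without loss in the
   constant; in particular the Lipschitz constant of [curve_term i] does not
   grow with i. *)
Let lip_join (f g : R -> R) (a b x y : R) : x <= a <= y ->
  f a = b -> g a = b ->
  `|f x - f a| <= curve_lip * `|x - a| -> `|g a - g y| <= curve_lip * `|a - y| ->
  `|f x - g y| <= curve_lip * `|x - y|.
Proof.
move=> /andP[xa ay] fa ga h1 h2.
have -> : f x - g y = (f x - f a) + (g a - g y) by rewrite fa ga; ring.
apply: (le_trans (ler_normD _ _)); apply: (le_trans (lerD h1 h2)).
rewrite -mulrDr ler_wpM2l ?(ltW lip0)// !ler0_norm; lra.
Qed.

Lemma tent_lip (x y : R) : `|tent x - tent y| <= curve_lip * `|x - y|.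
Proof.
have lipl u v : `|u / p - v / p| <= curve_lip * `|u - v|.
  rewrite -mulrBl normrM mulrC ler_wpM2r// ger0_norm ?invr_ge0 ?(ltW p0)//.
  by rewrite /curve_lip lerDl invr_ge0 ltW.
have lipr u v : `|(1 - u) / (1 - p) - (1 - v) / (1 - p)| <= curve_lip * `|u - v|.
  have -> : (1 - u) / (1 - p) - (1 - v) / (1 - p) = (v - u) / (1 - p).
    by field; rewrite gt_eqF.
  rewrite normrM mulrC distrC ler_wpM2r// ger0_norm ?invr_ge0 ?(ltW q0)//.
  by rewrite /curve_lip lerDr invr_ge0 ltW.
wlog xy : x y / x <= y.
  move=> h; have [/h//|/ltW /h] := leP x y.
  by rewrite distrC (distrC y).
have nn : 0 <= curve_lip * `|x - y| by rewrite mulr_ge0// ltW.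
have [x0|x0] := leP x 0.
  rewrite (tent_out x) ?x0//.
  have [y0|y0] := leP y 0; first by rewrite (tent_out y) ?y0// subr0 normr0.
  have [y1|y1] := leP 1 y; first by rewrite (tent_out y) ?y1 ?orbT// subr0 normr0.
  apply: (@lip_join (fun=> 0) tent 0 0) => //; first by rewrite x0 ltW.
  - by apply: tent_out; rewrite lexx.
  - by rewrite !subr0 normr0 mulr_ge0// ltW.
  have [yp|yp] := leP y p.
    by rewrite !tent_left ?lexx ?(ltW p0) ?(ltW y0)//.
  apply: (@lip_join tent tent p (p / p)); rewrite ?(ltW p0) ?(ltW yp)//.
  - by rewrite tent_left// (ltW p0) lexx.
  - by rewrite tent_left// (ltW p0) lexx.
  - by rewrite !tent_left ?lexx ?(ltW p0)//.
  - by rewrite !tent_right ?lexx ?(ltW p1) ?(ltW yp) ?(ltW y1)//.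
have [x1|x1] := leP 1 x.
  by rewrite !tent_out ?x1 ?(le_trans x1 xy) ?orbT// subr0 normr0.
have mid u v : 0 <= u -> u <= v -> v <= 1 -> `|tent u - tent v| <= curve_lip * `|u - v|.
  move=> u0 uv v1.
  have [vp|vp] := leP v p.
    by rewrite !tent_left ?vp ?u0 ?(le_trans u0 uv) ?(le_trans uv vp).
  have [pu|pu] := leP p u.
    by rewrite !tent_right ?v1 ?pu ?(ltW vp) ?(le_trans uv v1).
  apply: (@lip_join tent tent p (p / p)); rewrite ?(ltW pu) ?(ltW vp)//.
  - by rewrite tent_left// (ltW p0) lexx.
  - by rewrite tent_left// (ltW p0) lexx.
  - by rewrite !tent_left ?lexx ?(ltW p0) ?u0 ?(ltW pu).
  - by rewrite !tent_right ?lexx ?(ltW p1) ?(ltW vp).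
have [y1|y1] := leP y 1; first by apply: mid => //; exact: ltW.
rewrite (tent_out y) ?(ltW y1) ?orbT//.
apply: (@lip_join tent (fun=> 0) 1 0); rewrite ?(ltW x1) ?(ltW y1)//.
- by apply: tent_out; rewrite lexx orbT.
- by apply: mid => //; exact: ltW.
- by rewrite subr0 normr0 mulr_ge0// ltW.
Qed.

Lemma curve_term_lip i (x y : R) :
  `|curve_term i x - curve_term i y| <= curve_lip * `|x - y|.
Proof.
elim: i x y => [|i IH] x y; first exact: tent_lip.
wlog xy : x y / x <= y.
  move=> h; have [/h//|/ltW /h] := leP x y.
  by rewrite distrC (distrC y).
have L u v : u <= p -> v <= p ->
    `|curve_term i.+1 u - curve_term i.+1 v| <= curve_lip * `|u - v|.
  move=> up vp; rewrite !curve_term_left// -mulrBr normrM gtr0_norm//.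
  apply: (le_trans (ler_wpM2l (ltW p0) (IH _ _))).
  rewrite -mulrBl normrM (gtr0_norm (x := p^-1)) ?invr_gt0//.
  by rewrite le_eqVlt; apply/orP; left; apply/eqP; field; rewrite gt_eqF.
have Rr u v : p <= u -> p <= v ->
    `|curve_term i.+1 u - curve_term i.+1 v| <= curve_lip * `|u - v|.
  move=> up vp; rewrite !curve_term_right// -mulrBr normrM gtr0_norm//.
  apply: (le_trans (ler_wpM2l (ltW q0) (IH _ _))).
  rewrite -mulrBl normrM (gtr0_norm (x := (1 - p)^-1)) ?invr_gt0//.
  have -> : u - p - (v - p) = u - v by ring.
  by rewrite le_eqVlt; apply/orP; left; apply/eqP; field; rewrite gt_eqF.
have [yp|yp] := leP y p; first by apply: L => //; exact: le_trans yp.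
have [px|px] := leP p x; first by apply: Rr => //; exact: le_trans xy.
apply: (@lip_join (curve_term i.+1) (curve_term i.+1) p (curve_term i.+1 p)) => //.
- by rewrite (ltW px) (ltW yp).
- by apply: L => //; exact: ltW.
- by apply: Rr => //; exact: ltW.
Qed.

Let partial n x := series (fun i => curve_term i x) n.

Let partial_le n m x : partial (n + m)%N x <= partial n x + rate ^+ n / (1 - rate).
Proof.
have rr : 0 < 1 - rate by rewrite subr_gt0.
suff : partial (n + m)%N x <= partial n x + (rate ^+ n - rate ^+ (n + m)) / (1 - rate).
  move/le_trans; apply; rewrite lerD2l ler_pdivrMr// mulrVK ?unitfE ?gt_eqF//.
  by rewrite lerBlDr lerDl exprn_ge0// ltW.
elim: m => [|m IH]; first by rewrite addn0 subrr mul0r addr0.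
have /andP[_ b] := curve_term_bounds (n + m) x.
rewrite addnS /partial seriesSr; apply: (le_trans (lerD IH b)).
rewrite -addrA lerD2l exprS le_eqVlt; apply/orP; left; apply/eqP.
by field; rewrite gt_eqF.
Qed.

Let partial_nd x : {homo partial^~ x : n m / (n <= m)%N >-> n <= m}.
Proof.
apply/nondecreasing_series => i _ _.
by have /andP[] := curve_term_bounds i x.
Qed.

Let partial_cvg x : cvgn (partial^~ x).
Proof.
apply: nondecreasing_is_cvgn; first exact: partial_nd.
exists (partial 0 x + rate ^+ 0 / (1 - rate)) => _ [n _ <-].
exact: (partial_le 0 n).
Qed.

Lemma curve_tail n (x : R) :
  series (fun i => curve_term i x) n <= curve x <=
  series (fun i => curve_term i x) n + rate ^+ n / (1 - rate).
Proof.
apply/andP; split.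
  exact: (nondecreasing_cvgn_le (@partial_nd x) (@partial_cvg x)).
apply: (limr_le (@partial_cvg x)).
near=> m; have nm : (n <= m)%N by near: m; exists n.
by rewrite -[m](subnKC nm); exact: partial_le.
Unshelve. all: by end_near.
Qed.

Lemma curve_bounds (x : R) : 0 <= curve x <= (1 - rate)^-1.
Proof.
have /andP[a b] := curve_tail 0 x.
by move: a b; rewrite /series/= big_geq// add0r expr0 mul1r => -> ->.
Qed.

Lemma curve_out (x : R) : (x <= 0) || (1 <= x) -> curve x = 0.
Proof.
move=> h; rewrite /curve.
rewrite (_ : series _ = fun=> 0) ?lim_cst//.
by apply/funext => n; rewrite /series/= big1// => i _; rewrite curve_term_out.
Qed.

(** The n-th partial sum is a sum of n functions with a common Lipschitz
    constant, and the remainder is geometric. *)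
Lemma curve_modulus n (x y : R) : `|curve x - curve y| <=
  n%:R * curve_lip * `|x - y| + 2 * (rate ^+ n / (1 - rate)).
Proof.
have /andP[a b] := curve_tail n x.
have /andP[c d] := curve_tail n y.
have : `|series (curve_term^~ x) n - series (curve_term^~ y) n| <=
    n%:R * curve_lip * `|x - y|.
  rewrite /series/= -sumrB (le_trans (ler_norm_sum _ _ _))//.
  apply: (le_trans (ler_sum _ (fun i _ => curve_term_lip i x y))).
  by rewrite sumr_const_nat subn0 -[leLHS]mulr_natl mulrA.
rewrite !ler_norml => /andP[e f]; apply/andP; split; lra.
Qed.

Lemma curve_unif (e : R) : 0 < e ->
  exists2 d : R, 0 < d & forall x y, `|x - y| <= d -> `|curve x - curve y| <= e.
Proof.
move=> e0.
have : (fun n => 2 * (rate ^+ n / (1 - rate))) @ \oo --> (2 * (0 / (1 - rate)) : R).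
  apply: cvgMr; apply: cvgMl; apply: cvg_expr.
  by rewrite ger0_norm ?(ltW r0).
rewrite mul0r mulr0 => /cvgr0Pnorm_lt /(_ _ (divr_gt0 e0 (ltr0n R 2))).
move=> [n _ /(_ n (leqnn n)) /= hn].
exists (e / 2 / (n.+1%:R * curve_lip)).
  by rewrite !divr_gt0// mulr_gt0.
move=> x y hxy; apply: (le_trans (curve_modulus n x y)).
have := ler_norm (2 * (rate ^+ n / (1 - rate))).
have : n%:R * curve_lip * `|x - y| <= e / 2.
  rewrite ler_pdivlMr ?mulr_gt0// in hxy.
  apply: le_trans hxy; rewrite mulrC ler_wpM2l//.
  by rewrite ler_wpM2r ?ler_nat ?leqnSn// ltW.
lra.
Qed.

Lemma curve_continuous : continuous curve.
Proof.
move=> x; apply/cvgrPdist_le => e e0.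
have [d d0 h] := curve_unif e e0.
near=> y; apply: h; near: y.
by apply: cvgr_dist_le => //; exact: cvg_id.
Unshelve. all: by end_near.
Qed.

(** The fixed point equation behind the attractor; it splits into
    [curve_left] and [curve_right], which are the two affine maps of the
    attractor read on graphs. *)
Lemma curve_eqn (x : R) :
  curve x = tent x + p * curve (x / p) + (1 - p) * curve ((x - p) / (1 - p)).
Proof.
rewrite -addrA.
apply: cvg_lim; first exact: @Rhausdorff.
rewrite -(cvg_shiftS (partial^~ x)) /=.
rewrite (_ : (fun n => partial n.+1 x) = (fun n => tent x +
  (p * partial n (x / p) + (1 - p) * partial n ((x - p) / (1 - p))))).
  apply: cvgD; first exact: cvg_cst.
  by apply: cvgD; apply: cvgMr; exact: partial_cvg.
apply/funext => n; rewrite /partial /series /= big_nat_recl//=; congr (_ + _).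
by rewrite !mulr_sumr -big_split.
Qed.

Lemma curve_left (x : R) : 0 <= x <= 1 -> curve (p * x) = p * curve x + x.
Proof.
move=> /andP[x0 x1]; have px : p * x <= p by rewrite ler_piMr// ltW.
rewrite curve_eqn tent_left; last by rewrite px mulr_ge0// ltW.
rewrite (curve_out ((p * x - p) / (1 - p))) ?right_le0// mulr0 addr0.
by rewrite mulrAC mulfV ?gt_eqF// mul1r addrC.
Qed.

Lemma curve_right (x : R) : 0 <= x <= 1 ->
  curve ((1 - p) * x + p) = (1 - p) * curve x + (1 - x).
Proof.
move=> /andP[x0 x1]; have qx : 0 <= (1 - p) * x by rewrite mulr_ge0// ltW.
have qx1 : (1 - p) * x <= 1 - p by rewrite ler_piMr// ltW.
rewrite curve_eqn tent_right; last by lra.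
rewrite (curve_out (((1 - p) * x + p) / p)) ?left_ge1 ?orbT//; last by rewrite lerDr.
rewrite mulr0 addr0 addrK mulrAC mulfV ?gt_eqF// mul1r addrC; congr (_ + _).
by field; rewrite gt_eqF.
Qed.

Lemma curve_peak : curve p = 1.
Proof.
have := curve_left 1; rewrite mulr1 (curve_out 1) ?lexx ?orbT// mulr0 add0r.
by apply; rewrite ler01.
Qed.

End curve.

(** * The attractor is the graph of that series *)

Section attractor_graph.
Context {R : realType}.
Variable p : R.
Hypotheses (p0 : 0 < p) (p1 : p < 1).

Let q0 : 0 < 1 - p. Proof. by rewrite subr_gt0. Qed.
Let r0 := rate_gt0 p p0.
Let r1 := rate_lt1 p p0 p1.

(* A quantity that is contracted arbitrarily often vanishes. *)
Let expr_to0 (a b : R) : 0 <= b -> (forall n, `|a| <= rate p ^+ n * b) -> a = 0.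
Proof.
move=> b0 h; apply/eqP; rewrite -normr_le0.
have : (fun n => rate p ^+ n * b) @ \oo --> (0 * b : R).
  by apply: cvgMl; apply: cvg_expr; rewrite ger0_norm// ltW.
rewrite mul0r => c; rewrite -(cvg_lim _ c)//.
by apply: limr_ge; [apply/cvg_ex; exists 0 | near=> n].
Unshelve. all: by end_near.
Qed.

(** The vertical distance to the curve is bounded on the compact set E, and both
    maps contract it by [rate p]. *)
Lemma attractor_sub_graph (E : set (R * R)) : is_attractor p E ->
  forall z, E z -> z.2 = curve p z.1.
Proof.
move=> [_ cE E01 EE].
have [S S0 hS] : exists2 S : R, 0 <= S & forall z, E z -> `|z.2 - curve p z.1| <= S.
  have [M [_ hM]] := compact_bounded cE.
  exists (`|M| + 1 + (1 - rate p)^-1).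
    by rewrite !addr_ge0// invr_ge0 subr_ge0 ltW.
  move=> z Ez; have /hM/(_ z Ez) : M < `|M| + 1 by rewrite ltr_pwDr// ler_norm.
  rewrite /Num.norm/= => hz.
  apply: (le_trans (ler_normB _ _)); apply: lerD.
    by apply: le_trans hz; rewrite le_max lexx orbT.
  by have /andP[c0 c1] := curve_bounds p p0 p1 z.1; rewrite ger0_norm.
suff h n z : E z -> `|z.2 - curve p z.1| <= rate p ^+ n * S.
  by move=> z Ez; apply/eqP; rewrite -subr_eq0; apply/eqP;
    apply: (expr_to0 _ _ S0) => n; exact: h.
have [rp rq] := rate_ge p.
elim: n z => [|n IH] z Ez; first by rewrite mul1r; exact: hS.
move: Ez; rewrite EE exprS -mulrA => -[] [w Ew <-] /=.
all: have [/= w01 _] := E01 _ Ew; move: w01; rewrite in_itv/= => w01.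
- rewrite curve_left//.
  have -> : p * w.2 + w.1 - (p * curve p w.1 + w.1) = p * (w.2 - curve p w.1) by ring.
  by rewrite normrM gtr0_norm// ler_pM ?(ltW p0)//; exact: IH.
- rewrite curve_right//.
  have -> : (1 - p) * w.2 - w.1 + 1 - ((1 - p) * curve p w.1 + (1 - w.1)) =
    (1 - p) * (w.2 - curve p w.1) by ring.
  by rewrite normrM gtr0_norm// ler_pM ?(ltW q0)//; exact: IH.
Qed.

(** The first coordinates of E are dense in [0, 1], because the two maps of the
    interval contract and cover it; closedness of E and continuity of the curve
    then fill the graph. *)
Lemma attractor_full (E : set (R * R)) : is_attractor p E ->
  forall x, 0 <= x <= 1 -> E (x, curve p x).
Proof.
move=> aE; have gE := attractor_sub_graph _ aE.
have [[z0 Ez0] cE E01 EE] := aE.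
have [rp rq] := rate_ge p.
have dense n x : 0 <= x <= 1 -> exists2 z, E z & `|x - z.1| <= rate p ^+ n.
  elim: n x => [|n IH] x x01.
    exists z0 => //; rewrite expr0; have [/= + _] := E01 _ Ez0.
    by rewrite in_itv/= ler_norml; lra.
  have [xp|px] := leP x p.
    have [z Ez hz] : exists2 z, E z & `|x / p - z.1| <= rate p ^+ n.
      apply: IH; rewrite divr_ge0 ?(ltW p0) ?ler_pdivrMr ?mul1r//.
      by case/andP: x01.
    exists (alphaL p z); first by rewrite EE; left; exists z.
    rewrite /= exprS (_ : x - p * z.1 = p * (x / p - z.1)); last first.
      by field; rewrite gt_eqF.
    by rewrite normrM gtr0_norm// ler_pM ?(ltW p0).
  have [z Ez hz] : exists2 z, E z & `|(x - p) / (1 - p) - z.1| <= rate p ^+ n.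
    apply: IH; rewrite divr_ge0 ?(ltW q0) ?subr_ge0 ?(ltW px)//=.
    by rewrite ler_pdivrMr// mul1r; lra.
  exists (alphaR p z); first by rewrite EE; right; exists z.
  rewrite /= exprS.
  rewrite (_ : x - ((1 - p) * z.1 + p) =
    (1 - p) * ((x - p) / (1 - p) - z.1)); last first.
    by field; rewrite gt_eqF.
  by rewrite normrM gtr0_norm// ler_pM ?(ltW q0).
move=> x x01.
have /choice[z hz] : forall n, exists z, E z /\ `|x - z.1| <= rate p ^+ n.
  by move=> n; have [z] := dense n x x01; exists z.
have z1 : (fun n => (z n).1) @ \oo --> x.
  have /cvgr0Pnorm_le e : (fun n => rate p ^+ n) @ \oo --> (0 : R).
    by apply: cvg_expr; rewrite ger0_norm// ltW.
  apply/cvgrPdist_le => eps /e; apply: filterS => n.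
  by apply: le_trans; apply: (le_trans (hz n).2); exact: ler_norm.
have clE : closed E by apply: compact_closed => //; exact: norm_hausdorff.
have c : (fun n => ((z n).1, curve p (z n).1)) @ \oo --> (x, curve p x).
  have z2 := cvg_comp _ _ z1 (curve_continuous p p0 p1 x).
  exact: (cvg_pair z1 z2).
have Ec : \forall n \near \oo, E ((z n).1, curve p (z n).1).
  by apply: nearW => n; rewrite -gE; [case: (z n) (hz n) => ? ? [] | case: (hz n)].
exact: (closed_cvg E clE Ec _ c).
Qed.

Lemma attractor_exists : is_attractor p
  [set (x, curve p x) | x in `[0, 1]].
Proof.
split.
- by exists (0, curve p 0), 0 => //; rewrite /= in_itv/= lexx ler01.
- apply: continuous_compact; last exact: segment_compact.
  apply: continuous_subspaceT => x.
  exact: (cvg_pair cvg_id (curve_continuous p p0 p1 x)).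
- by move=> _ [x x01 <-]; split.
apply/seteqP; split.
  move=> _ [x + <-]; rewrite /= in_itv/= => x01.
  have [xp|px] := leP x p.
    have u01 : 0 <= x / p <= 1.
      rewrite divr_ge0 ?(ltW p0) ?ler_pdivrMr ?mul1r ?xp//.
      by case/andP: x01.
    left; exists (x / p, curve p (x / p)); first by exists (x / p).
    rewrite /alphaL /= -curve_left//; congr (_, curve _ _);
    by field; rewrite gt_eqF.
  have u01 : 0 <= (x - p) / (1 - p) <= 1.
    rewrite divr_ge0 ?(ltW q0) ?subr_ge0 ?(ltW px)//=.
    by rewrite ler_pdivrMr// mul1r; lra.
  right; exists ((x - p) / (1 - p), curve p ((x - p) / (1 - p))).
    by exists ((x - p) / (1 - p)).
  rewrite /alphaR /=; have e : (1 - p) * ((x - p) / (1 - p)) + p = x.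
    by field; rewrite gt_eqF.
  by rewrite e -addrA [X in _ + X]addrC -curve_right// e.
move=> _ [] [_ [x + <-] <-]; rewrite /= in_itv/= => x01.
  exists (p * x); last by rewrite /alphaL/= curve_left.
  have [x0 x1] := andP x01.
  by rewrite in_itv/= mulr_ge0 ?mulr_ile1 ?(ltW p0) ?(ltW p1).
exists ((1 - p) * x + p); last by rewrite /alphaR/= curve_right//; congr (_, _); ring.
have [x0 x1] := andP x01.
have qx0 : 0 <= (1 - p) * x by rewrite mulr_ge0// ltW.
have qx1 : (1 - p) * x <= 1 - p by rewrite ler_piMr// ltW.
by rewrite in_itv/= addr_ge0 ?(ltW p0)//= -lerBrDr.
Qed.

Lemma limit_curveE (x : R) : 0 <= x <= 1 -> limit_curve p x = curve p x.
Proof.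
move=> x01; have aE : is_attractor p (attractor p).
  by apply: getI; exact: attractor_exists.
rewrite /limit_curve.
have : [set y | attractor p (x, y)] (get [set y | attractor p (x, y)]).
  by apply: (@getI _ _ (curve p x)); exact: attractor_full.
by move/(attractor_sub_graph _ aE).
Qed.

End attractor_graph.

(** * Suprema and essential suprema *)

Section Linfty_sup.
Context {R : realType}.
Implicit Types f : R -> R.

Lemma lebesgue01_gt0 : (0 < @lebesgue01 R setT)%E.
Proof.
rewrite /lebesgue01 /mrestr setTI lebesgue_measure_itv/= lte_fin ltr01.
by rewrite -EFinD subr0 lte_fin.
Qed.

Lemma Linfty01_le f (a : R) :
  (forall x : R, 0 <= x <= 1 -> `|f x| <= a) -> (Linfty01 f <= a%:E)%E.
Proof.
move=> fa; rewrite /Linfty01 unlock lebesgue01_gt0.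
apply/ess_supP; exists (~` `[0, 1]); split.
- by apply: measurableC; exact: measurable_itv.
- transitivity (@lebesgue_measure R set0); last exact: measure0.
  by congr (lebesgue_measure _); exact: setICl.
- move=> x /= h; rewrite in_itv/= => x01; apply: h.
  by rewrite lee_fin; exact: fa.
Qed.

(** Near x, any interval of positive length contains a point where the essential
    bound holds. *)
Lemma Linfty01_ge f (x : R) : 0 <= x <= 1 ->
  (forall e : R, 0 < e -> exists2 d : R, 0 < d &
    forall y, 0 <= y <= 1 -> `|x - y| <= d -> `|f x| <= `|f y| + e) ->
  (`|f x|%:E <= Linfty01 f)%E.
Proof.
move=> x01 fc; rewrite /Linfty01 unlock lebesgue01_gt0.
have [N [mN N0 sN]] := ess_sup_ge (@lebesgue01 R) (abse \o (EFin \o f)).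
apply/lee_addgt0Pr => e e0; have [d d0 hd] := fc e e0.
pose a := Num.max 0 (x - d); pose b := Num.min 1 (x + d).
have ab : a < b by rewrite /a /b gt_max !lt_min; lra.
have [y [yab yN]] : exists y, y \in `[a, b] /\ ~ N y.
  apply: contrapT => h.
  have abN : `[a, b] `<=` N.
    by move=> y yab; apply: contrapT => yN; apply: h; exists y.
  have ab01 : `[a, b] `<=` `[0, 1].
    move=> y /=; rewrite !in_itv/= /a /b ge_max le_min => /andP[/andP[-> _]].
    by case/andP.
  have : (@lebesgue01 R `[a, b] <= lebesgue01 N)%E.
    by apply: le_measure; rewrite ?inE//; exact: measurable_itv.
  have -> : @lebesgue01 R `[a, b] = lebesgue_measure (`[a, b]%classic : set R).
    by congr (lebesgue_measure _); apply/setIidPl.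
  rewrite N0 lebesgue_measure_itv/=.
  by rewrite lte_fin ab -EFinD lee_fin subr_le0 leNgt ab.
move: yab; rewrite in_itv/= /a /b ge_max le_min => /andP[/andP[ya yx] /andP[yb xy]].
have hy : `|f x| <= `|f y| + e.
  by apply: hd; rewrite ?ya ?yb// ler_norml; lra.
apply: (@le_trans _ _ (`|f y|%:E + e%:E)%E); first by rewrite -EFinD lee_fin.
by apply: leeD => //; apply: contrapT => h; apply: yN; apply: sN.
Qed.

End Linfty_sup.

Section curve_norm.
Context {R : realType}.
Variable p : R.
Hypotheses (p0 : 0 < p) (p1 : p < 1).

Definition curve_sup : R := sup [set `|curve p x| | x in `[0, 1]].

Lemma curve_has_sup : has_sup [set `|curve p x| | x in `[0, 1]].
Proof.
split; first by exists `|curve p 0|, 0 => //; rewrite /= in_itv/= lexx ler01.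
exists (1 - rate p)^-1 => _ [x _ <-].
by have /andP[c0 c1] := curve_bounds p p0 p1 x; rewrite ger0_norm.
Qed.

Lemma curve_le_sup (x : R) : `|curve p x| <= curve_sup.
Proof.
have [h|h] := boolP (0 <= x <= 1).
  by apply: (ub_le_sup curve_has_sup.2); exists x => //; exact: h.
rewrite curve_out//; last first.
  by move: h; rewrite negb_and -!ltNge => /orP[/ltW ->//|/ltW ->]; rewrite orbT.
rewrite normr0; apply: (le_trans (normr_ge0 (curve p 0))).
by apply: (ub_le_sup curve_has_sup.2); exists 0 => //; rewrite /= in_itv/= lexx ler01.
Qed.

Lemma curve_sup_ge1 : 1 <= curve_sup.
Proof. by have := curve_le_sup p; rewrite curve_peak// normr1. Qed.

(** By continuity the essential supremum is the supremum. *)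
Lemma Linfty01_limit_curve : Linfty01 (limit_curve p) = curve_sup%:E.
Proof.
apply/eqP; rewrite eq_le; apply/andP; split.
  apply: Linfty01_le => x x01; rewrite limit_curveE//.
  exact: curve_le_sup.
have fin : Linfty01 (limit_curve p) \is a fin_num.
  rewrite ge0_fin_numE ?Lnorm_ge0//; apply: le_lt_trans (ltry curve_sup).
  apply: Linfty01_le => x x01; rewrite limit_curveE//.
  exact: curve_le_sup.
rewrite -(fineK fin) lee_fin; apply: ge_sup; first by have [] := curve_has_sup.
move=> _ [x + <-]; rewrite /= in_itv/= => x01; rewrite -lee_fin fineK//.
rewrite -limit_curveE//; apply: Linfty01_ge => // e e0.
have [d d0 hd] := curve_unif p p0 p1 e e0.
exists d => // y y01 /hd h; rewrite !limit_curveE//.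
by rewrite -lerBlDl (le_trans _ h)// lerB_dist.
Qed.

End curve_norm.

(** * Deviations of piecewise linear paths *)

Section interpolation.
Context {R : realType}.
Implicit Types (S : nat -> R) (t : R) (s : seq R).

(** The pattern of [ergodic_interp] for an arbitrary sequence, so that partial
    sums along a word and along an orbit can be compared. *)
Definition interp S t : R :=
  let j := Num.truncn t in S j + (t - j%:R) * (S j.+1 - S j).

Lemma interp_nat S n : interp S n%:R = S n.
Proof. by rewrite /interp natrK subrr mul0r addr0. Qed.

(** On [0, N] the interpolation only involves S 0, ..., S N: at the right end
    the increment to S N.+1 has coefficient 0. *)
Lemma interpP S N t (Q : R -> Prop) : 0 <= t <= N%:R ->
  (t = N%:R -> Q (S N)) ->
  (forall j, (j < N)%N -> j%:R <= t < j.+1%:R ->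
    Q (S j + (t - j%:R) * (S j.+1 - S j))) ->
  Q (interp S t).
Proof.
move=> /andP[t0 tN] QN Qj.
have [tE|tE] := eqVneq t N%:R; first by rewrite tE interp_nat; exact: QN.
have jt := truncn_itv t0; apply: Qj => //.
by rewrite truncn_lt_nat// lt_neqAle tE.
Qed.

Lemma eq_interp S S' N t : (forall j, (j <= N)%N -> S j = S' j) ->
  0 <= t <= N%:R -> interp S t = interp S' t.
Proof.
move=> SS tN; apply: (interpP S N t (fun y => y = interp S' t)) => //.
  by move=> ->; rewrite interp_nat SS.
move=> j jN jt; rewrite /interp (truncn_def jt) !SS//; exact: ltnW.
Qed.

Lemma interp_shift S n t : 0 <= t ->
  interp S (n%:R + t) = interp (fun j => S (n + j)%N) t.
Proof.
move=> t0; have /andP[a b] := truncn_itv t0.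
rewrite /interp (_ : Num.truncn (n%:R + t) = (n + Num.truncn t)%N); last first.
  by apply: truncn_def; rewrite -addnS !natrD lerD2l a ltrD2l.
by rewrite addnS natrD; congr (_ + _ * _); ring.
Qed.

Lemma interp_cst S (c t : R) : interp (fun j => c + S j) t = c + interp S t.
Proof. by rewrite /interp; ring. Qed.

Lemma interp_bound S N t (B : R) : (forall j, (j <= N)%N -> `|S j| <= B) ->
  0 <= t <= N%:R -> `|interp S t| <= B.
Proof.
move=> SB tN; apply: (interpP S N t (fun y => `|y| <= B)) => //.
  by move=> _; exact: SB.
move=> j jN /andP[jt tj].
have : j.+1%:R = j%:R + 1 :> R by rewrite -natr1.
move=> e; rewrite e in tj.
have := SB _ (ltnW jN); have := SB _ jN.
rewrite !ler_norml => /andP[a b] /andP[c d].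
set u := t - j%:R; have u0 : 0 <= u by rewrite subr_ge0.
have u1 : 0 <= 1 - u by rewrite /u; lra.
have -> : S j + u * (S j.+1 - S j) = (1 - u) * S j + u * S j.+1 by ring.
have A1 := ler_wpM2l u1 c; have A2 := ler_wpM2l u1 d.
have A3 := ler_wpM2l u0 a; have A4 := ler_wpM2l u0 b.
by apply/andP; split; lra.
Qed.

Definition psum s (j : nat) : R := \sum_(i < j) s`_i.

Lemma psum_catl s1 s2 j : (j <= size s1)%N -> psum (s1 ++ s2) j = psum s1 j.
Proof.
move=> js; apply: eq_bigr => i _.
by rewrite nth_cat (leq_trans (ltn_ord i) js).
Qed.

Lemma psum_catr s1 s2 j :
  psum (s1 ++ s2) (size s1 + j) = psum s1 (size s1) + psum s2 j.
Proof.
rewrite /psum big_split_ord /=; congr (_ + _); apply: eq_bigr => i _.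
  by rewrite nth_cat ltn_ord.
by rewrite nth_cat ltnNge leq_addr /= addKn.
Qed.

Definition word_dev s t : R :=
  interp (psum s) (t * (size s)%:R) - t * psum s (size s).

Section cat.
Variables s1 s2 : seq R.
Hypotheses (s1_gt0 : (0 < size s1)%N) (s2_gt0 : (0 < size s2)%N).

Let L : R := (size (s1 ++ s2))%:R.
Let lam : R := (size s1)%:R / L.
Let c : R := psum s1 (size s1) - lam * psum (s1 ++ s2) (size (s1 ++ s2)).

Let L0 : L != 0.
Proof. by rewrite pnatr_eq0 size_cat -lt0n addn_gt0 s1_gt0. Qed.
Let lamL : lam * L = (size s1)%:R.
Proof. by rewrite mulfVK. Qed.
Let LE : L = (size s1)%:R + (size s2)%:R.
Proof. by rewrite /L size_cat natrD. Qed.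

(** On the lower part of a concatenation the chord of the whole and the chord
    of the part differ by a linear function; c is its value at the cut. *)
Lemma word_dev_catl (u : R) : 0 <= u <= 1 ->
  word_dev (s1 ++ s2) (lam * u) = word_dev s1 u + u * c.
Proof.
move=> /andP[u0 u1]; rewrite /word_dev -/L mulrAC lamL (mulrC _ u).
rewrite (@eq_interp (psum (s1 ++ s2)) (psum s1) (size s1)).
- by rewrite /c; ring.
- by move=> j; exact: psum_catl.
- by rewrite mulr_ge0//= ler_piMl.
Qed.

Lemma word_dev_catr (u : R) : 0 <= u <= 1 ->
  word_dev (s1 ++ s2) (lam + (1 - lam) * u) = word_dev s2 u + (1 - u) * c.
Proof.
move=> /andP[u0 u1]; rewrite /word_dev -/L.
have -> : (lam + (1 - lam) * u) * L = (size s1)%:R + u * (size s2)%:R.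
  transitivity (lam * L + u * (L - lam * L)); first by ring.
  by rewrite lamL LE; ring.
rewrite interp_shift ?mulr_ge0//.
rewrite (_ : (fun j => _) = (fun j => psum s1 (size s1) + psum s2 j)); last first.
  by apply/funext => j; rewrite psum_catr.
rewrite interp_cst /c.
rewrite {1 2}size_cat psum_catr; set a := psum s1 _; set b := psum s2 _.
by rewrite /word_dev; ring.
Qed.

End cat.

Lemma word_dev_bound s (t : R) : (forall i, `|s`_i| <= 1) -> 0 <= t <= 1 ->
  `|word_dev s t| <= 2 * (size s)%:R.
Proof.
move=> s1 /andP[t0 t1].
have ps j : (j <= size s)%N -> `|psum s j| <= (size s)%:R.
  move=> js; apply: (le_trans (ler_norm_sum _ _ _)).
  apply: (@le_trans _ _ (\sum_(i < j) 1)); first by apply: ler_sum.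
  by rewrite sumr_const card_ord ler_nat.
rewrite mulr_natl mulr2n; apply: (le_trans (ler_normB _ _)); apply: lerD.
  by apply: (interp_bound _ _ _ _ ps); rewrite mulr_ge0//= ler_piMl.
rewrite normrM ger0_norm//; apply: (le_trans (ler_wpM2l t0 (ps _ (leqnn _)))).
by rewrite ler_piMl.
Qed.

(** Passing to a suffix only changes the chord: both sides vanish at t = 1, and
    the correction (1 - t) makes them agree at t = 0. *)
Lemma interp_suffix s i S l (t : R) : (0 < l)%N -> size s = (i + l)%N ->
  (forall j, (j <= l)%N -> S j = psum s (i + j) - psum s i) -> 0 <= t <= 1 ->
  let sg := i%:R / (size s)%:R in
  interp S (t * l%:R) - t * interp S l%:R =
  word_dev s (sg + (1 - sg) * t) - (1 - t) * word_dev s sg.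
Proof.
move=> l0 sz SE /andP[t0 t1] sg.
have L0 : (size s)%:R != 0 :> R by rewrite pnatr_eq0 sz -lt0n addn_gt0 l0 orbT.
have sgL : sg * (size s)%:R = i%:R by rewrite mulfVK.
have LE : (size s)%:R = i%:R + l%:R :> R by rewrite sz natrD.
rewrite interp_nat SE// -sz.
rewrite (@eq_interp _ (fun j => - psum s i + psum s (i + j)) l); first last.
- by rewrite mulr_ge0//= ler_piMl.
- by move=> j jl; rewrite SE// addrC.
rewrite interp_cst -interp_shift ?mulr_ge0// /word_dev sgL interp_nat.
have -> : (sg + (1 - sg) * t) * (size s)%:R = i%:R + t * l%:R.
  transitivity (sg * (size s)%:R + t * ((size s)%:R - sg * (size s)%:R)); first by ring.
  by rewrite sgL LE; ring.
ring.
Qed.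

End interpolation.

(** * Orbits climb the towers *)

Section towers.
Context {R : realType}.
Local Notation tower := (@tower R).
Local Arguments Defs.tower : simpl never.

Definition in_rung (n : nat) (a x : R) := a <= x < a + 2 ^- n.

Lemma towerS n k : (0 < n)%N -> tower n.+1 k =
  (if k is j.+1 then [seq a + 2 ^- n.+1 | a <- tower n j] else [::]) ++ tower n k.
Proof. by case: n. Qed.

Lemma size_tower n k : (0 < n)%N -> size (tower n k) = 'C(n, k).
Proof.
case: n => // n _; elim: n k => [|n IH] k.
  by case: k => [|[|k]].
rewrite towerS// size_cat IH; case: k => [|k]; first by rewrite !bin0.
by rewrite size_map IH binS addnC.
Qed.

Lemma towerS_left n k i : (0 < n)%N -> (i < 'C(n, k))%N ->
  (tower n.+1 k.+1)`_i = (tower n k)`_i + 2 ^- n.+1.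
Proof.
move=> n0 ik; rewrite towerS// nth_cat size_map size_tower// ik.
by rewrite (nth_map 0) ?size_tower.
Qed.

(** The number of rungs stacked under the left half of the k-th tower. *)
Definition below n k := if k is j.+1 then 'C(n, j) else 0%N.

Lemma towerS_right n k i : (0 < n)%N ->
  (tower n.+1 k)`_(below n k + i) = (tower n k)`_i.
Proof.
move=> n0; rewrite towerS//; case: k => [//|k].
by rewrite nth_cat size_map size_tower//= ltnNge leq_addr /= addKn.
Qed.

Lemma below_bin n k : 'C(n.+1, k) = (below n k + 'C(n, k))%N.
Proof. by case: k => [|k]; rewrite ?bin0// binS addnC. Qed.

Let halfS n : 2 ^- n.+1 + 2 ^- n.+1 = 2 ^- n :> R.
Proof. by rewrite exprS; field; rewrite expf_neq0. Qed.

Let half0 n : 0 < 2 ^- n :> R.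
Proof. by rewrite invr_gt0 exprn_gt0. Qed.

Lemma tower_half n k i : (0 < n)%N -> (i < 'C(n, k))%N ->
  let a := (tower n k)`_i in
  (0 <= a /\ a + 2 ^- n <= 2^-1) \/ (2^-1 <= a /\ a + 2 ^- n <= 1).
Proof.
case: n => // n _; elim: n k i => [|n IH] k i.
  have h : 2^-1 + 2^-1 = 1 :> R by lra.
  have t0 : tower 1 0 = [:: 0] by [].
  have t1 : tower 1 1 = [:: 2^-1] by [].
  case: k i => [|[|k]] [|i]//= _; rewrite ?t0 ?t1 ?expr1 /=; [left|right]; split; lra.
have h0 := half0 n.+2; have hS := halfS n.+1.
rewrite below_bin; have [ik|ik] := ltnP i (below n.+1 k).
  case: k ik => [//|k] /= ik _.
  rewrite towerS_left//; case: (IH _ _ ik) => /= -[a b]; [left|right].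
    by split; lra.
  by split; lra.
rewrite -{1}(subnKC ik) ltn_add2l => ik'.
rewrite -(subnKC ik) towerS_right//.
by case: (IH _ _ ik') => /= -[a b]; [left|right]; split; lra.
Qed.

Lemma rungS_left n a x : a + 2 ^- n.+1 <= x -> in_rung n a x ->
  in_rung n.+1 (a + 2 ^- n.+1) x.
Proof. by rewrite /in_rung -addrA halfS => -> /andP[_ ->]. Qed.

Lemma rungS_right n a x : x < a + 2 ^- n.+1 -> in_rung n a x -> in_rung n.+1 a x.
Proof. by rewrite /in_rung => -> /andP[-> _]. Qed.

(** A rung of stage n.+1 determines its parent by halving, and the position of
    the point in the left or right half of the parent determines the rung. *)
Lemma rung_disjoint n k k' i i' x : (0 < n)%N ->
  (i < 'C(n, k))%N -> (i' < 'C(n, k'))%N ->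
  in_rung n (tower n k)`_i x -> in_rung n (tower n k')`_i' x ->
  k = k' /\ i = i'.
Proof.
case: n => // n _; elim: n k k' i i' => [|n IH] k k' i i'.
  have h : 2^-1 + 2^-1 = 1 :> R by lra.
  have t0 : tower 1 0 = [:: 0] by [].
  have t1 : tower 1 1 = [:: 2^-1] by [].
  case: k i => [|[|k]] [|i]//= _; case: k' i' => [|[|k']] [|i']//= _;
    rewrite /in_rung ?t0 ?t1 ?expr1 /= => a b; exfalso; move: a b h; lra.
have h0 := half0 n.+2; have hS := halfS n.+1.
have dec l j : (j < 'C(n.+2, l))%N -> in_rung n.+2 (tower n.+2 l)`_j x ->
    exists l' j', [/\ (j' < 'C(n.+1, l'))%N, in_rung n.+1 (tower n.+1 l')`_j' x &
    if (tower n.+1 l')`_j' + 2 ^- n.+2 <= x then l = l'.+1 /\ j = j'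
    else l = l' /\ j = (below n.+1 l + j')%N].
  rewrite below_bin; have [jl|jl] := ltnP j (below n.+1 l).
    case: l jl => [//|l] /= jl _; rewrite towerS_left// => /andP[a b].
    exists l, j; split => //; last by rewrite a.
    by rewrite /in_rung; lra.
  rewrite -{1}(subnKC jl) ltn_add2l => jl'.
  rewrite -{1}(subnKC jl) towerS_right// => /andP[a b].
  exists l, (j - below n.+1 l)%N; split => //; last by rewrite leNgt b /= subnKC.
  by rewrite /in_rung; lra.
move=> ik ik' /(dec _ _ ik)[l [j [jl r e]]] /(dec _ _ ik')[l' [j' [jl' r' e']]].
have [El Ej] := IH _ _ _ _ jl jl' r r'.
by move: e e'; rewrite -El -Ej; case: ifP => _ [-> ->] [-> ->].
Qed.

(** T is translation by the difference of two consecutive endpoints, and both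
    consecutive rungs are cut at the same places. *)
Lemma step_refine m n k i x : (0 < n)%N -> (i.+1 < 'C(n, k))%N ->
  in_rung n (tower n k)`_i x -> exists k' i',
  [/\ (i'.+1 < 'C(m + n, k'))%N, in_rung (m + n) (tower (m + n) k')`_i' x &
   (tower n k)`_i.+1 - (tower n k)`_i =
   (tower (m + n) k')`_i'.+1 - (tower (m + n) k')`_i'].
Proof.
move=> n0 ik r; elim: m => [|m [k' [i' [ik' r' e]]]]; first by exists k, i.
have mn0 : (0 < m + n)%N by rewrite addn_gt0 n0 orbT.
have [h|h] := leP ((tower (m + n) k')`_i' + 2 ^- (m + n).+1) x.
  exists k'.+1, i'; rewrite addSn !towerS_left ?(ltnW ik')//; split.
  - by rewrite below_bin (leq_trans ik')// leq_addr.
  - exact: rungS_left.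
  - by rewrite e; ring.
exists k', (below (m + n) k' + i')%N; rewrite addSn -addnS !towerS_right//; split => //.
- by rewrite below_bin ltn_add2l.
- exact: rungS_right.
Qed.

Lemma pascal_graph_rung n k i x : (0 < n)%N -> (i.+1 < 'C(n, k))%N ->
  in_rung n (tower n k)`_i x ->
  pascal_graph x (x - (tower n k)`_i + (tower n k)`_i.+1).
Proof.
move=> n0 ik r; exists n, k, i; split => //; last by rewrite size_tower.
by have := leq_ltn_trans (leq0n _) ik; rewrite bin_gt0.
Qed.

(** The pair of rungs chosen by [get] may belong to another stage; refining both
    pairs to a common stage, where rungs are disjoint, identifies the two
    translations. *)
Lemma pascalT_rung n k i x : (0 < n)%N -> (i.+1 < 'C(n, k))%N ->
  in_rung n (tower n k)`_i x ->
  pascalT x = x - (tower n k)`_i + (tower n k)`_i.+1.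
Proof.
move=> n0 ik r; have := pascal_graph_rung _ _ _ _ n0 ik r.
move/(@getI _ (pascal_graph x)) => [n' [k' [i' [n0' _ ik' r' Tx]]]].
rewrite /pascalT {}Tx; rewrite size_tower// in ik'.
have [l [j [jl q e]]] := step_refine n' _ _ _ _ n0 ik r.
have [l' [j' [jl' q' e']]] := step_refine n _ _ _ _ n0' ik' r'.
rewrite addnC in jl' q' e'.
have nn : (0 < n' + n)%N by rewrite addn_gt0 n0 orbT.
have [El Ej] := rung_disjoint _ _ _ _ _ _ nn (ltnW jl) (ltnW jl') q q'.
by rewrite -[RHS]addrA -addrA; congr (_ + _); rewrite addrC e' -El -Ej -e addrC.
Qed.

Lemma iter_pascalT n k i x j : (0 < n)%N -> (i + j < 'C(n, k))%N ->
  in_rung n (tower n k)`_i x ->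
  iter j pascalT x = x - (tower n k)`_i + (tower n k)`_(i + j) /\
  in_rung n (tower n k)`_(i + j) (iter j pascalT x).
Proof.
move=> n0; elim: j => [|j IH] ij r.
  by rewrite addn0 subrK.
rewrite addnS in ij; have [e r'] := IH (ltnW ij) r.
rewrite iterS (pascalT_rung _ _ _ _ n0 ij r') e addnS; split; first by ring.
by move: r; rewrite /in_rung; lra.
Qed.

Lemma orbit_defined_rung n k i x l : (0 < n)%N -> 'C(n, k) = (i + l)%N ->
  in_rung n (tower n k)`_i x -> orbit_defined x l.
Proof.
move=> n0 il r j jl.
have h : ((i + j).+1 < 'C(n, k))%N by rewrite il -addnS ltn_add2l.
have [_ r'] := iter_pascalT _ _ _ _ _ n0 (ltnW h) r.
by eexists; exact: pascal_graph_rung r'.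
Qed.

(** g is constant on each rung, so these are its values along the tower. *)
Definition word n k : seq R := [seq g_half a | a <- tower n k].

Lemma size_word n k : (0 < n)%N -> size (word n k) = 'C(n, k).
Proof. by move=> n0; rewrite size_map size_tower. Qed.

Lemma g_halfE (x : R) : 0 <= x < 1 -> g_half x = if x < 2^-1 then 1 else -1.
Proof.
move=> /andP[x0 x1]; rewrite /g_half !indicE.
case: ifPn => h.
  rewrite mem_set ?memNset ?subr0//=; rewrite in_itv/= ?x0//.
  by apply/negP; rewrite negb_and -ltNge h.
rewrite -leNgt in h.
rewrite memNset ?mem_set ?sub0r//=; rewrite in_itv/= ?h//.
by apply/negP; rewrite negb_and -leNgt h orbT.
Qed.

Lemma g_half_rung n k i x : (0 < n)%N -> (i < 'C(n, k))%N ->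
  in_rung n (tower n k)`_i x -> g_half x = (word n k)`_i.
Proof.
move=> n0 ik r; rewrite (nth_map 0) ?size_tower//.
have := tower_half _ _ _ n0 ik; move: r; rewrite /in_rung.
set a := _`_i => /andP[ax xa] /= [] [h1 h2]; have := half0 n; have h3 := half0 1.
  move=> e0; have h4 := halfS 0; rewrite expr1 expr0 invr1 in h3 h4.
  rewrite !g_halfE; [|lra..].
  by rewrite !ifT//; lra.
move=> e0; have h4 := halfS 0; rewrite expr1 expr0 invr1 in h3 h4.
rewrite !g_halfE; [|lra..].
by rewrite !ifF//; apply/negbTE; rewrite -leNgt; lra.
Qed.

(** Shifting a rung to its right half does not change the value of g. *)
Lemma wordS n k : (0 < n)%N -> word n.+1 k.+1 = word n k ++ word n k.+1.
Proof.
move=> n0; rewrite /word towerS// map_cat; congr (_ ++ _).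
apply: (@eq_from_nth _ 0); rewrite !size_map// => i; rewrite size_tower// => ik.
rewrite (nth_map 0) ?size_map ?size_tower// (nth_map 0) ?size_tower//.
have e0 := half0 n.+1; have eS := halfS n.
rewrite -/(word n k).
apply: (g_half_rung n k) => //; rewrite /in_rung; lra.
Qed.

Lemma word_norm n k i : `|(word n k)`_i| <= 1.
Proof.
have [ik|ik] := ltnP i (size (word n k)); last by rewrite nth_default// normr0.
have [n0|n0] := posnP n; first by move: ik; rewrite n0.
rewrite size_word// in ik; rewrite (nth_map 0) ?size_tower//.
have := tower_half _ _ _ n0 ik; have := half0 n; have h3 := half0 1.
have h4 := halfS 0; rewrite expr1 expr0 invr1 in h3 h4.
set a := _`_i => e0 /= h; rewrite g_halfE; last by case: h; lra.
by case: ifP; rewrite ?normrN normr1.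
Qed.

Lemma ergodic_sum_rung n k i x j : (0 < n)%N -> (i + j <= 'C(n, k))%N ->
  in_rung n (tower n k)`_i x ->
  ergodic_sum g_half x j = psum (word n k) (i + j) - psum (word n k) i.
Proof.
move=> n0 ij r.
have -> : psum (word n k) (i + j) =
    psum (word n k) i + \sum_(m < j) (word n k)`_(i + m).
  by rewrite /psum big_split_ord.
rewrite [RHS]addrC addKr.
apply: eq_bigr => m _; have im : (i + m < 'C(n, k))%N.
  by rewrite (leq_trans _ ij)// ltn_add2l.
have [_ r'] := iter_pascalT _ _ _ _ _ n0 im r.
exact: g_half_rung r'.
Qed.

Lemma ergodic_dev_rung n k i x l (t : R) : (0 < n)%N -> (0 < l)%N ->
  'C(n, k) = (i + l)%N -> in_rung n (tower n k)`_i x -> 0 <= t <= 1 ->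
  let sg := i%:R / ('C(n, k))%:R in
  ergodic_dev g_half x l t =
  word_dev (word n k) (sg + (1 - sg) * t) - (1 - t) * word_dev (word n k) sg.
Proof.
move=> n0 l0 il r t01 sg; rewrite /sg -(size_word n k n0).
apply: interp_suffix => //; first by rewrite size_word.
by move=> j jl; apply: ergodic_sum_rung => //; rewrite il leq_add2l.
Qed.

End towers.

(** * The self-similar recursion of the tower words *)

Section word_limit.
Context {R : realType}.
Local Notation word := (@word R).

Lemma psum_word n k : (0 < n)%N ->
  n%:R * psum (word n k) 'C(n, k) = 'C(n, k)%:R * (n%:R - 2 * k%:R) :> R.
Proof.
case: n => // n _; elim: n k => [|n IH] k.
  have g0 : g_half (0 : R) = 1.
    by rewrite g_halfE ?lexx ?ltr01// invr_gt0 ltr0n.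
  have g1 : g_half (2^-1 : R) = -1 by rewrite g_halfE ?ltxx//; lra.
  rewrite mul1r; case: k => [|[|k]].
  - by rewrite bin0 /psum big_ord1 /= g0; ring.
  - by rewrite bin1 /psum big_ord1 /= g1; ring.
  - by rewrite bin_small// /psum big_ord0 mul0r.
case: k => [|k].
  have := IH 0%N; rewrite !bin0 (_ : word n.+2 0 = word n.+1 0)// => h.
  have e : psum (word n.+1 0) 1 = 1.
    apply: (@mulfI R n.+1%:R); first by rewrite pnatr_eq0.
    by rewrite h; ring.
  by rewrite e; ring.
rewrite wordS// binS addnC.
rewrite -{1}(@size_word R n.+1 k)// psum_catr size_word//.
have h1 := IH k; have h2 := IH k.+1.
have /(congr1 (fun i => i%:R : R)) := mul_bin_diag n.+2 k.
rewrite binS /= !natrM natrD addrC.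
rewrite [(k.+1)%:R]mulrSr [n.+2%:R]mulrSr => h3.
rewrite [(k.+1)%:R]mulrSr in h2.
have n0 : n.+1%:R != 0 :> R by rewrite pnatr_eq0.
apply: (mulfI n0); rewrite natrD.
move: h1 h2 h3 n0.
set N := n.+1%:R; set K := k%:R; set a := 'C(_, k)%:R; set b := 'C(_, k.+1)%:R.
set A := psum _ _; set B := psum _ _ => h1 h2 h3 n0.
transitivity ((N + 1) * (N * A) + (N + 1) * (N * B)); first by ring.
rewrite h1 h2.
transitivity ((N + 1) * (a + b) * (N - 2 * K - 2) + 2 * ((N + 1) * a)); first by ring.
by rewrite h3; ring.
Qed.

(** The height of the deviation of [word n k] at the cut between its two parts,
    see [word_dev_recl]. *)
Definition amp n k : R :=
  2 * 'C(n, k)%:R * k%:R * (n%:R - k%:R) / (n%:R ^+ 2 * (n%:R - 1)).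

Lemma amp_ge0 n k : (0 < n)%N -> 0 <= amp n k.
Proof.
move=> n0; have [kn|nk] := leqP k n; last first.
  by rewrite /amp bin_small// mulr0 !mul0r.
rewrite /amp divr_ge0// mulr_ge0//.
- by rewrite subr_ge0 ler_nat.
- by rewrite subr_ge0 ler1n.
Qed.

Section step.
Variables n k : nat.
Hypotheses (n2 : (1 < n)%N) (kn : (k < n)%N).

Let N : R := n%:R.
Let K : R := k%:R.
Let N1 : 1 < N. Proof. by rewrite /N ltr1n. Qed.
Let NS : n.+1%:R = N + 1. Proof. by rewrite /N natr1. Qed.
Let KS : k.+1%:R = K + 1. Proof. by rewrite /K natr1. Qed.
Let n0 : (0 < n)%N. Proof. exact: ltnW. Qed.

Let binl : (N + 1) * 'C(n, k)%:R = (K + 1) * 'C(n.+1, k.+1)%:R.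
Proof.
by have /(congr1 (fun i => i%:R : R)) := mul_bin_diag n.+1 k; rewrite !natrM NS KS.
Qed.

Let binD : 'C(n.+1, k.+1)%:R = 'C(n, k)%:R + 'C(n, k.+1)%:R :> R.
Proof. by rewrite binS natrD addrC. Qed.

Let N0 : N != 0. Proof. by rewrite gt_eqF// (lt_trans ltr01). Qed.
Let Nm : N - 1 != 0. Proof. by rewrite gt_eqF// subr_gt0. Qed.
Let Np : N + 1 != 0. Proof. by rewrite gt_eqF// ltr_wpDl. Qed.

Let clE : 'C(n, k)%:R = (K + 1) * 'C(n.+1, k.+1)%:R / (N + 1) :> R.
Proof. by rewrite -binl mulrAC mulfV// mul1r. Qed.

Let crE : 'C(n, k.+1)%:R = (N - K) * 'C(n.+1, k.+1)%:R / (N + 1) :> R.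
Proof.
have -> : 'C(n, k.+1)%:R = 'C(n.+1, k.+1)%:R - 'C(n, k)%:R :> R by rewrite binD; ring.
by rewrite clE; field.
Qed.

Lemma amp_left : amp n k = amp n.+1 k.+1 * ((N + 1) * K / (N * (N - 1))).
Proof.
by rewrite /amp clE NS KS -/N -/K; field; rewrite N0 Nm Np.
Qed.

Lemma amp_right :
  amp n k.+1 = amp n.+1 k.+1 * ((N + 1) * (N - K - 1) / (N * (N - 1))).
Proof.
by rewrite /amp crE NS KS -/N -/K; field; rewrite N0 Nm Np.
Qed.

(** The self-affine recursion. The drift of each part is known from
    [psum_word], and [amp n.+1 k.+1] is the resulting difference between the
    chord of the lower part and the chord of the whole, at the cut. *)
Lemma word_dev_recl (u : R) : 0 <= u <= 1 ->
  word_dev (word n.+1 k.+1) ((K + 1) / (N + 1) * u) =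
  word_dev (word n k) u + u * amp n.+1 k.+1 /\
  word_dev (word n.+1 k.+1) ((K + 1) / (N + 1) + (1 - (K + 1) / (N + 1)) * u) =
  word_dev (word n k.+1) u + (1 - u) * amp n.+1 k.+1.
Proof.
move=> u01.
have s1 : (0 < size (word n k))%N by rewrite size_word// bin_gt0 ltnW.
have s2 : (0 < size (word n k.+1))%N by rewrite size_word// bin_gt0.
have C0 : 'C(n.+1, k.+1)%:R != 0 :> R.
  by rewrite pnatr_eq0 -lt0n bin_gt0 ltnS ltnW.
have sz : size (word n k ++ word n k.+1) = 'C(n.+1, k.+1).
  by rewrite -wordS// size_word.
have lamE : (K + 1) / (N + 1) =
    (size (word n k))%:R / (size (word n k ++ word n k.+1))%:R.
  rewrite sz size_word//; apply: (mulIf C0); rewrite mulfVK// clE.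
  by rewrite mulrAC.
have cE : amp n.+1 k.+1 = psum (word n k) (size (word n k)) -
    (K + 1) / (N + 1) * psum (word n k ++ word n k.+1)
      (size (word n k ++ word n k.+1)).
  rewrite sz -wordS// size_word//.
  have h1 := psum_word n k n0; have h2 := psum_word n.+1 k.+1 isT.
  rewrite NS KS in h2; rewrite -/N -/K clE in h1.
  have -> : psum (word n k) 'C(n, k) =
    (K + 1) * 'C(n.+1, k.+1)%:R / (N + 1) * (N - 2 * K) / N.
    by rewrite -h1 mulrAC mulfV// mul1r.
  have -> : psum (word n.+1 k.+1) 'C(n.+1, k.+1) =
    'C(n.+1, k.+1)%:R * (N + 1 - 2 * (K + 1)) / (N + 1).
    by rewrite -h2 mulrAC mulfV// mul1r.
  by rewrite /amp NS KS; field; rewrite Np N0.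
rewrite wordS// cE lamE; split; first exact: word_dev_catl.
exact: word_dev_catr.
Qed.

Variable p : R.
Hypotheses (p0 : 0 < p) (p1 : p < 1).
Variables (d s w m e rho : R).
Hypotheses (Mw : forall x y : R, `|x - y| <= d -> `|curve p x - curve p y| <= w).
Hypothesis Mm : forall x : R, `|curve p x| <= m.
Hypothesis lam_p : `|(K + 1) / (N + 1) - p| <= d.
Hypothesis ratl : `|(N + 1) * K / (N * (N - 1)) - p| <= s.
Hypothesis ratr : `|(N + 1) * (N - K - 1) / (N * (N - 1)) - (1 - p)| <= s.
Hypotheses (e0 : 0 <= e) (rhol : p + s <= rho) (rhor : 1 - p + s <= rho).
Hypothesis IHl : forall t : R, 0 <= t <= 1 ->
  `|word_dev (word n k) t - amp n k * curve p t| <= amp n k * e.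
Hypothesis IHr : forall t : R, 0 <= t <= 1 ->
  `|word_dev (word n k.+1) t - amp n k.+1 * curve p t| <= amp n k.+1 * e.

(* The common estimate for both parts: D is the deviation of the part, r the
   ratio of its amplitude to A, q the limit of this ratio, y the ramp, M and x
   the curve at the point and at its image under the limit map, z the curve at
   the actual point. *)
Let branch (A q r D x y z M : R) : 0 <= A -> `|r - q| <= s -> q + s <= rho ->
  `|M| <= m -> `|z - x| <= w -> x = q * M + y ->
  `|D - A * r * M| <= A * r * e ->
  `|D + y * A - A * z| <= A * (rho * e + s * m + w).
Proof.
move=> A0 rq qs Mm' zx xE h.
have -> : D + y * A - A * z = (D - A * r * M) + A * ((r - q) * M) - A * (z - x).
  by rewrite xE; ring.
have r_rho : r <= rho.
  by apply: le_trans qs; rewrite -lerBlDl (le_trans _ rq)// ler_norm.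
apply: (le_trans (ler_normB _ _)); rewrite [leRHS]mulrDr; apply: lerD; last first.
  by rewrite normrM ger0_norm// ler_wpM2l.
apply: (le_trans (ler_normD _ _)); rewrite [leRHS]mulrDr; apply: lerD.
  by apply: (le_trans h); rewrite -mulrA ler_wpM2l// ler_wpM2r.
by rewrite normrM ger0_norm// normrM ler_wpM2l// ler_pM.
Qed.

(** One level of the recursion multiplies the relative error by rho, at the
    price of the error s on the amplitudes and of the oscillation w of the
    curve between the cut points lambda and p. *)
Lemma word_dev_step (t : R) : 0 <= t <= 1 ->
  `|word_dev (word n.+1 k.+1) t - amp n.+1 k.+1 * curve p t| <=
  amp n.+1 k.+1 * (rho * e + s * m + w).
Proof.
move=> /andP[t0 t1]; set lam := (K + 1) / (N + 1).
have A0 := @amp_ge0 n.+1 k.+1 isT.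
have K0 : 0 <= K by rewrite /K.
have KN : K + 1 <= N by rewrite -KS /N ler_nat.
have l0 : 0 < lam by rewrite divr_gt0//; lra.
have l1 : lam < 1 by rewrite ltr_pdivrMr ?mul1r; lra.
have [tl|tl] := leP t lam.
  have u01 : 0 <= t / lam <= 1.
    by rewrite divr_ge0 ?(ltW l0)// ler_pdivrMr// mul1r tl.
  have tE : t = lam * (t / lam) by rewrite mulrC mulfVK// gt_eqF.
  rewrite {1 2}tE (word_dev_recl _ u01).1.
  apply: (@branch _ p ((N + 1) * K / (N * (N - 1))) _
    (curve p (p * (t / lam))) _ _ (curve p (t / lam))) => //.
  - apply: Mw; rewrite -mulrBl normrM -[leRHS]mulr1.
    by apply: ler_pM => //; rewrite ger0_norm; case/andP: u01.
  - exact: curve_left.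
  - by rewrite -amp_left; exact: IHl.
have u01 : 0 <= (t - lam) / (1 - lam) <= 1.
  rewrite divr_ge0 ?subr_ge0 ?(ltW l1) ?(ltW tl)//=.
  by rewrite ler_pdivrMr ?subr_gt0// mul1r; lra.
set u := (t - lam) / (1 - lam) in u01 *.
have tE : t = lam + (1 - lam) * u.
  by rewrite /u; field; rewrite subr_eq0 gt_eqF.
rewrite {1 2}tE (word_dev_recl _ u01).2.
apply: (@branch _ (1 - p) ((N + 1) * (N - K - 1) / (N * (N - 1))) _
    (curve p ((1 - p) * u + p)) _ _ (curve p u)) => //.
- apply: Mw.
  have -> : lam + (1 - lam) * u - ((1 - p) * u + p) = (lam - p) * (1 - u) by ring.
  rewrite normrM -[leRHS]mulr1.
  by apply: ler_pM => //; rewrite ger0_norm; case/andP: u01; lra.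
- exact: curve_right.
- by rewrite -amp_right; exact: IHr.
Qed.

End step.
End word_limit.

(** * Convergence of the tower words *)

Section word_limit_thm.
Context {R : realType}.
Local Notation word := (@word R).

(** The numerator of the difference is (N + 1) (K + 1 - p (N + 1)) up to a term
    of size 3 (N + 1), while N (N - 1) is at least (N + 1)^2 / 4. *)
Lemma amp_ratio_bound (N K p d : R) : 3 <= N -> 0 < p < 1 -> 0 <= d ->
  `|K + 1 - p * (N + 1)| <= d * (N + 1) ->
  `|(N + 1) * K / (N * (N - 1)) - p| <= 4 * d + 12 / (N + 1).
Proof.
move=> N3 /andP[p0 p1] d0; set y := K + 1 - p * (N + 1) => hy.
have NN : 0 < N * (N - 1) by apply: mulr_gt0; lra.
have Np : 0 < N + 1 by lra.
have -> : (N + 1) * K / (N * (N - 1)) - p =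
    ((N + 1) * y + (3 * p * N - N - 1 + p)) / (N * (N - 1)).
  by rewrite /y; field; rewrite subr_eq0 !gt_eqF//; lra.
rewrite normrM [X in _ * X]gtr0_norm ?invr_gt0// ler_pdivrMr//.
apply: (@le_trans _ _ (d * (N + 1) ^+ 2 + 3 * (N + 1))).
  apply: (le_trans (ler_normD _ _)); apply: lerD.
    by rewrite normrM gtr0_norm// expr2 mulrA mulrC ler_wpM2r// ltW.
  have pN : p * N <= N by rewrite ler_piMl; lra.
  have pN0 : 0 <= p * N by rewrite mulr_ge0; lra.
  by rewrite ler_norml; apply/andP; split; lra.
have -> : d * (N + 1) ^+ 2 + 3 * (N + 1) =
    (4 * d + 12 / (N + 1)) * ((N + 1) ^+ 2 / 4).
  by field; rewrite gt_eqF.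
apply: ler_wpM2l; first by rewrite addr_ge0 ?mulr_ge0 ?invr_ge0// ltW.
nra.
Qed.

Lemma amp_ratio_bounds (N K p d : R) : 3 <= N -> 0 < p < 1 -> 0 <= d ->
  `|K + 1 - p * (N + 1)| <= d * (N + 1) ->
  `|(K + 1) / (N + 1) - p| <= d /\
  `|(N + 1) * K / (N * (N - 1)) - p| <= 4 * d + 12 / (N + 1) /\
  `|(N + 1) * (N - K - 1) / (N * (N - 1)) - (1 - p)| <= 4 * d + 12 / (N + 1).
Proof.
move=> N3 p01 d0 h; have Np : 0 < N + 1 by lra.
split; [|split].
- rewrite (_ : _ / _ - p = (K + 1 - p * (N + 1)) / (N + 1)); last first.
    by field; rewrite gt_eqF.
  by rewrite normrM [X in _ * X]gtr0_norm ?invr_gt0 ?ler_pdivrMr.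
- exact: amp_ratio_bound.
- apply: amp_ratio_bound => //; first by lra.
  rewrite (_ : _ - _ = - (K + 1 - p * (N + 1))) ?normrN//; ring.
Qed.

(** One level down, k - p n changes by p or 1 - p, which the unit decrease of r
    compensates while n - r is unchanged. *)
Lemma region_step (p d k n r : R) : 0 < p < 1 ->
  `|k + 1 - p * (n + 1)| + (r + 1) <= d * (n + 1 - (r + 1)) ->
  `|k - p * n| + r <= d * (n - r) /\ `|k + 1 - p * n| + r <= d * (n - r).
Proof.
move=> p01; rewrite (_ : n + 1 - (r + 1) = n - r); last by ring.
set y := k + 1 - p * (n + 1) => h.
have -> : k - p * n = y - (1 - p) by rewrite /y; ring.
have -> : k + 1 - p * n = y + p by rewrite /y; ring.
have h1 := ler_normB y (1 - p); have h2 := ler_normD y p.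
rewrite (ger0_norm (x := 1 - p)) in h1; last by lra.
rewrite (ger0_norm (x := p)) in h2; last by lra.
by split; lra.
Qed.

Lemma contraction_fixed (rho c N m B T : R) : 0 <= rho < 1 -> 0 <= c -> 0 <= B ->
  rho * (c * (N * B + m) + T / (1 - rho)) + T <=
  rho * c * ((N + 1) * B + m) + T / (1 - rho).
Proof.
move=> /andP[r0 r1] c0 B0; rewrite -subr_ge0.
have -> : rho * c * ((N + 1) * B + m) + T / (1 - rho) -
    (rho * (c * (N * B + m) + T / (1 - rho)) + T) = rho * c * B.
  by field; rewrite subr_eq0 gt_eqF.
by rewrite !mulr_ge0.
Qed.

Variable p : R.
Hypotheses (p0 : 0 < p) (p1 : p < 1).

(** The deviation is at most twice the length of the word, and the amplitude is
    at least of order b^2 / n times this length. *)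
Lemma word_dev_base n k (b : R) : (1 < n)%N -> 0 < b ->
  b * n%:R <= k%:R -> b * n%:R <= n%:R - k%:R ->
  forall t : R, 0 <= t <= 1 ->
  `|word_dev (word n k) t - amp n k * curve p t| <=
  amp n k * (n%:R / b ^+ 2 + curve_sup p).
Proof.
move=> n2 b0 h1 h2 t t01; have n0 : (0 < n)%N by exact: ltnW.
have A0 := @amp_ge0 R n k n0.
apply: (le_trans (ler_normB _ _)); rewrite [leRHS]mulrDr; apply: lerD; last first.
  by rewrite normrM ger0_norm// ler_wpM2l// curve_le_sup.
apply: (le_trans (word_dev_bound _ _ (word_norm n k) t01)).
have N1 : 1 < n%:R :> R by rewrite ltr1n.
rewrite size_word// /amp; set N := n%:R in N1 h1 h2 *; set K := k%:R in h1 h2 *.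
have -> : 2 * 'C(n, k)%:R * K * (N - K) / (N ^+ 2 * (N - 1)) * (N / b ^+ 2) =
    2 * 'C(n, k)%:R * ((K * (N - K)) / (b ^+ 2 * N * (N - 1))).
  by field; rewrite subr_eq0 !gt_eqF//; lra.
rewrite ler_peMr ?mulr_ge0// ler_pdivlMr ?mul1r; last first.
  by rewrite !mulr_gt0 ?exprn_gt0//; lra.
apply: (@le_trans _ _ ((b * N) * (b * N))); last first.
  have bN : 0 <= b * N by rewrite mulr_ge0; lra.
  by apply: ler_pM.
have -> : b * N * (b * N) = b ^+ 2 * N * N by ring.
rewrite ler_wpM2l ?mulr_ge0 ?sqr_ge0//; lra.
Qed.

(** Induction on the number r of levels over which the contraction is used. The
    region is shaped so that both predecessors of (n, k) for r.+1 lie in the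
    region for r, and k / n stays within d of p in all of them. *)
Lemma word_dev_region (d s w rho b : R) (n0 : nat) :
  (4 <= n0)%N -> 0 < b -> 0 < d <= 1 -> b <= p - d -> b <= 1 - p - d ->
  (forall x y : R, `|x - y| <= d -> `|curve p x - curve p y| <= w) ->
  4 * d + 12 / n0%:R <= s -> p + s <= rho -> 1 - p + s <= rho ->
  rho < 1 ->
  forall r n k, (n0 + r <= n)%N -> `|k%:R - p * n%:R| + r%:R <= d * (n%:R - r%:R) ->
  forall t : R, 0 <= t <= 1 ->
  `|word_dev (word n k) t - amp n k * curve p t| <=
  amp n k * (rho ^+ r * (n%:R / b ^+ 2 + curve_sup p) +
             (s * curve_sup p + w) / (1 - rho)).
Proof.
move=> n04 b0 /andP[d0 d1] bp bq Mw hs rp rq r1.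
have N04 : 4 <= n0%:R :> R by rewrite ler_nat.
have n00 : 0 < n0%:R :> R by lra.
have s0 : 0 <= s.
  by apply: le_trans hs; rewrite addr_ge0 ?mulr_ge0 ?invr_ge0//; lra.
have r0 : 0 < rho by lra.
have m0 : 0 <= curve_sup p by apply: le_trans (curve_sup_ge1 p p0 p1).
have w0 : 0 <= w by have := Mw 0 0; rewrite !subrr normr0; apply; exact: ltW.
have rr : 0 < 1 - rho by rewrite subr_gt0.
have E0 : 0 <= (s * curve_sup p + w) / (1 - rho).
  by rewrite divr_ge0 ?(ltW rr)// addr_ge0// mulr_ge0.
elim=> [|r IH] n k.
  rewrite addn0 addr0 subr0 expr0 mul1r => n0n reg t t01.
  have n4 : 4 <= n%:R :> R by apply: le_trans N04 _; rewrite ler_nat.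
  have n2 : (1 < n)%N by apply: leq_trans n0n; apply: leq_trans n04.
  have A0 := @amp_ge0 R n k (ltnW n2).
  move: reg; rewrite ler_norml => /andP[g1 g2].
  have c1 : b * n%:R <= (p - d) * n%:R by rewrite ler_wpM2r//; lra.
  have c2 : b * n%:R <= (1 - p - d) * n%:R by rewrite ler_wpM2r//; lra.
  apply: (le_trans (word_dev_base n k b n2 b0 _ _ t t01)); [lra|lra|].
  by rewrite ler_wpM2l// lerDl.
case: n => [|n]; first by rewrite addnS.
case: k => [|k].
  rewrite addnS ltnS => n0n; rewrite sub0r normrN.
  rewrite ger0_norm ?mulr_ge0 ?(ltW p0)// => reg t t01; exfalso.
  have : 0 < (p - d) * n.+1%:R by rewrite mulr_gt0//; lra.
  have : 0 <= r.+1%:R * (1 + d) by rewrite mulr_ge0//; lra.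
  move: reg; lra.
rewrite addnS ltnS => n0n reg t t01.
have n4 : (4 <= n)%N by apply: leq_trans n04 (leq_trans (leq_addr _ _) n0n).
have N4 : 4 <= n%:R :> R by rewrite ler_nat.
have r00 : 0 <= r%:R :> R by [].
have NS : n.+1%:R = n%:R + 1 :> R by rewrite natr1.
have KS : k.+1%:R = k%:R + 1 :> R by rewrite natr1.
have rS : r.+1%:R = r%:R + 1 :> R by rewrite natr1.
rewrite NS KS rS in reg.
have p01 : 0 < p < 1 by rewrite p0.
have [reg1 reg2] := region_step _ _ _ _ _ p01 reg.
have lam_d : `|k%:R + 1 - p * (n%:R + 1)| <= d * (n%:R + 1).
  have : 0 <= d * r%:R by rewrite mulr_ge0// ltW.
  by move: reg d0 r00; clear -p0 p1; lra.
have kn : (k < n)%N.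
  rewrite -(ltr_nat R); move: lam_d; rewrite ler_norml => /andP[_].
  have : 0 < (1 - p - d) * n%:R.
    by apply: mulr_gt0; [move: bq b0 | move: N4]; clear -p0 p1; lra.
  by move: d1 p1 bq b0; clear -p0 p1; lra.
have n0S : n0%:R <= n%:R + 1 :> R.
  by rewrite -NS ler_nat leqW// (leq_trans _ n0n)// leq_addr.
have hs' : 4 * d + 12 / (n%:R + 1) <= s.
  apply: le_trans hs; rewrite lerD2l; apply: ler_wpM2l => //.
  by rewrite lef_pV2 ?posrE// (lt_le_trans n00).
have e0 : 0 <= rho ^+ r * (n%:R / b ^+ 2 + curve_sup p) +
             (s * curve_sup p + w) / (1 - rho).
  rewrite addr_ge0// mulr_ge0 ?exprn_ge0 ?(ltW r0)//.
  by rewrite addr_ge0// divr_ge0 ?sqr_ge0.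
have N3 : 3 <= n%:R :> R by rewrite ler_nat ltnW.
have [rat [ratl ratr]] := amp_ratio_bounds _ _ _ _ N3 p01 (ltW d0) lam_d.
have n2 : (1 < n)%N by apply: leq_trans n4.
have step := @word_dev_step R n k n2 kn p p0 p1 d s w (curve_sup p)
  _ rho Mw (curve_le_sup p p0 p1) rat (le_trans ratl hs') (le_trans ratr hs')
  e0 rp rq _ _ t t01.
apply: (le_trans (step _ _)); first exact: IH.
  by apply: IH => //; rewrite KS.
apply: ler_wpM2l; first exact: amp_ge0.
rewrite (exprS rho) NS -[leLHS]addrA; apply: contraction_fixed.
- by rewrite (ltW r0).
- by rewrite exprn_ge0// ltW.
- by rewrite invr_ge0 sqr_ge0.
Qed.

Lemma geometric_linear (x : R) r : 0 <= x < 1 -> r.+1%:R * x ^+ r <= (1 - x)^-1.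
Proof.
move=> /andP[x0 x1]; have xx : 0 < 1 - x by rewrite subr_gt0.
rewrite -div1r ler_pdivlMr//.
suff : r.+1%:R * x ^+ r * (1 - x) <= 1 - x ^+ r.+1.
  by move/le_trans; apply; rewrite lerBlDr lerDl exprn_ge0.
elim: r => [|r IH]; first by rewrite !mul1r expr1.
have xr : x ^+ r.+1 <= 1 by rewrite exprn_ile1// ltW.
have h1 : x * (r.+1%:R * x ^+ r * (1 - x)) <= x * (1 - x ^+ r.+1) by rewrite ler_wpM2l.
have h2 : x ^+ r.+1 * (1 - x) <= 1 - x by rewrite ler_piMl// ltW.
rewrite -natr1 !(exprS _ r.+1) in h2 *; rewrite exprS in h2 *.
move: h1 h2; rewrite exprS; lra.
Qed.

(** With y^2 = x, one factor y^r absorbs the linear term and the other tends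
    to 0. *)
Lemma linear_geometric_small (x K e : R) : 0 < x < 1 -> 0 <= K -> 0 < e ->
  exists r0, forall r, (r0 <= r)%N -> x ^+ r * (r.+1%:R * K) <= e.
Proof.
move=> /andP[x0 x1] K0 e0; pose y := Num.sqrt x.
have y0 : 0 < y by rewrite sqrtr_gt0.
have yy : y ^+ 2 = x by rewrite sqr_sqrtr// ltW.
have y1 : y < 1 by rewrite -(@ltr_pXn2r _ 2) ?nnegrE ?(ltW y0)// yy expr1n.
have : (fun n => y ^+ n * (K / (1 - y))) @ \oo --> (0 * (K / (1 - y)) : R).
  by apply: cvgMl; apply: cvg_expr; rewrite ger0_norm// ltW.
rewrite mul0r => /cvgr0Pnorm_le /(_ _ e0) [r0 _ h].
exists r0 => r /h /= hr; apply: le_trans hr; apply: le_trans (ler_norm _).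
rewrite -yy exprAC expr2 -mulrA ler_pM2l ?exprn_gt0//.
by rewrite mulrA (mulrC _ K) ler_wpM2l// mulrC geometric_linear// (ltW y0).
Qed.

(** The number of contraction steps is a small fraction d / 4 of n: small enough
    to remain in the region where k / n is near p, large enough for rho^r to
    beat the linear bound of [word_dev_base]. *)
Lemma word_dev_limit (e : R) : 0 < e -> exists2 d : R, 0 < d & exists n0 : nat,
  forall n k, (n0 <= n)%N -> `|k%:R - p * n%:R| <= d * n%:R ->
  0 < amp n k :> R /\ forall t : R, 0 <= t <= 1 ->
  `|word_dev (word n k) t - amp n k * curve p t| <= amp n k * e.
Proof.
move=> e0.
have R1 := rate_lt1 p p0 p1; have [Rp Rq] := rate_ge p.
(* rho lies strictly between the limit contraction factor and 1; the error s on
   the ratios of amplitudes has to fit in between. *)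
pose rho := (1 + rate p) / 2.
have rho1 : 0 < 1 - rho by rewrite /rho; lra.
have rho0 : 0 < rho by rewrite /rho; lra.
have m1 := curve_sup_ge1 p p0 p1.
have m0 : 0 < curve_sup p by lra.
pose w := (1 - rho) * e / 4; have w0 : 0 < w by rewrite divr_gt0// mulr_gt0.
have [dw dw0 Mw] := curve_unif p p0 p1 w w0.
pose s := Num.min ((1 - rate p) / 2) (w / curve_sup p).
have s0 : 0 < s by rewrite lt_min (divr_gt0 w0 m0) andbT divr_gt0// subr_gt0.
have s1 : s <= (1 - rate p) / 2 by rewrite ge_min lexx.
have s2 : s * curve_sup p <= w by rewrite -ler_pdivlMr// ge_min lexx orbT.
pose b := Num.min p (1 - p) / 2.
have b0 : 0 < b by rewrite divr_gt0// lt_min p0 subr_gt0.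
have bp : 2 * b <= p by rewrite /b mulrC mulfVK// ge_min lexx.
have bq : 2 * b <= 1 - p by rewrite /b mulrC mulfVK// ge_min lexx orbT.
pose d := Num.min b (Num.min dw (s / 8)).
have d0 : 0 < d by rewrite !lt_min b0 dw0 divr_gt0.
have db : d <= b by rewrite ge_min lexx.
have dd : d <= dw by rewrite !ge_min lexx !orbT.
have ds : d <= s / 8 by rewrite !ge_min lexx !orbT.
have d1 : d <= 1 by lra.
(* 24 / s makes the term 12 / n0 of the ratio bound at most s / 2. *)
pose n0 := maxn 4 (Num.truncn (24 / s)).+1.
have n04 : (4 <= n0)%N by rewrite leq_maxl.
have hs : 4 * d + 12 / n0%:R <= s.
  have N0 : 24 / s <= n0%:R.
    by apply: le_trans (ltW (truncnS_gt _)) _; rewrite ler_nat leq_maxr.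
  have NN : 0 < n0%:R :> R by rewrite ltr0n; apply: leq_trans n04.
  have : 12 / n0%:R <= s / 2.
    rewrite ler_pdivrMr// mulrAC ler_pdivlMr//.
    by rewrite ler_pdivrMr// mulrC in N0; lra.
  lra.
have t1 : (s * curve_sup p + w) / (1 - rho) <= e / 2.
  rewrite ler_pdivrMr//; have : w = (1 - rho) * e / 4 by [].
  by move: s2; clear -p0 p1; lra.
have H := word_dev_region d s w rho b n0 n04 b0 _ _ _ _ hs _ _ _.
have {}H : forall r n k, (n0 + r <= n)%N ->
    `|k%:R - p * n%:R| + r%:R <= d * (n%:R - r%:R) ->
    forall t : R, 0 <= t <= 1 ->
    `|word_dev (word n k) t - amp n k * curve p t| <=
    amp n k * (rho ^+ r * (n%:R / b ^+ 2 + curve_sup p) +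
             (s * curve_sup p + w) / (1 - rho)).
  apply: H => //.
  - by rewrite d0.
  - by move: db bp; clear -p0 p1; lra.
  - by move: db bq; clear -p0 p1; lra.
  - by move=> x y xy; apply: Mw; apply: le_trans dd.
  - by rewrite /rho; move: s1 Rp; clear -p0 p1; lra.
  - by rewrite /rho; move: s1 Rq; clear -p0 p1; lra.
  - by rewrite -subr_gt0.
have rho01 : 0 < rho < 1 by rewrite rho0 -subr_gt0.
clear hs s1 s2 s0 ds dd Mw Rp Rq R1 rho0 rho1 w0.
clearbody n0 d b s rho w.
pose dl := d / 4; have dl0 : 0 < dl by rewrite divr_gt0.
pose K := (b ^- 2 / dl + curve_sup p).
have K0 : 0 <= K by rewrite addr_ge0 ?(ltW m0)// divr_ge0 ?(ltW dl0)// invr_ge0 sqr_ge0.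
have [r0 hr0] :=
  linear_geometric_small rho K (e / 2) rho01 K0 (divr_gt0 e0 (ltr0n R 2)).
exists dl => //; exists (maxn (2 * n0) (Num.truncn (r0.+1%:R / dl)).+1) => n k.
rewrite geq_max => /andP[n2 n3] reg.
have N2 : 2 * n0%:R <= n%:R :> R by rewrite -natrM ler_nat.
have N04 : 4 <= n0%:R :> R by rewrite ler_nat.
have Nr : r0.+1%:R <= dl * n%:R.
  rewrite mulrC -ler_pdivrMr//; apply: le_trans (ltW (truncnS_gt _)) _.
  by rewrite ler_nat.
pose r := Num.truncn (dl * n%:R).
have dn0 : 0 <= dl * n%:R by rewrite mulr_ge0// ltW.
have /andP[rl ru] := truncn_itv dn0; rewrite -/r in rl ru.
have r0r : (r0 <= r)%N.
  rewrite -ltnS -(ltr_nat R); apply: le_lt_trans ru.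
  by apply: le_trans Nr; rewrite ler_nat.
have dlE : dl * n%:R = d * n%:R / 4 by rewrite /dl mulrAC.
have dn : d * n%:R <= n%:R by rewrite ler_piMl.
have dr : d * r%:R <= r%:R by rewrite ler_piMl.
rewrite dlE in reg rl.
have n0r : (n0 + r <= n)%N.
  by rewrite -(ler_nat R) natrD; move: rl dn N2 N04; clear -p0 p1; lra.
have reg' : `|k%:R - p * n%:R| + r%:R <= d * (n%:R - r%:R).
  by rewrite mulrBr; move: reg rl dr dn dn0 dlE; clear -p0 p1; lra.
have n1 : 1 < n%:R :> R by move: N2 N04; clear -p0 p1; lra.
have n1p : 0 < n%:R :> R by apply: lt_trans n1.
have [kb kn] : b * n%:R <= k%:R /\ b * n%:R <= n%:R - k%:R.
  move: reg; rewrite ler_norml => /andP[g1 g2].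
  have h1 : 2 * b * n%:R <= p * n%:R by rewrite ler_wpM2r.
  have h2 : 2 * b * n%:R <= (1 - p) * n%:R by rewrite ler_wpM2r.
  have h3 : d * n%:R <= b * n%:R by rewrite ler_wpM2r.
  by move: g1 g2 h1 h2 h3 dn0 dlE; clear -p0 p1; split; lra.
have bn : 0 < b * n%:R by apply: mulr_gt0.
have k_gt0 := lt_le_trans bn kb; have nk_gt0 := lt_le_trans bn kn.
have A0 : 0 < amp n k :> R.
  rewrite /amp divr_gt0 ?(mulr_gt0, exprn_gt0, subr_gt0)//; last first.
    by rewrite -subr_gt0.
  by rewrite ltr0n bin_gt0 -(ler_nat R) -subr_ge0 ltW.
split => // t t01.
apply: le_trans (H r n k n0r reg' t t01) _.
rewrite ler_pM2l//.
have t2 : rho ^+ r * (n%:R / b ^+ 2 + curve_sup p) <= e / 2.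
  apply: le_trans (hr0 _ r0r); rewrite ler_pM2l ?exprn_gt0//; last by case/andP: rho01.
  rewrite mulrDr; apply: lerD.
    rewrite mulrCA mulrC ler_wpM2l ?invr_ge0 ?sqr_ge0//.
    by rewrite ler_pdivlMr// mulrC ltW.
  by rewrite ler_peMl ?(ltW m0)// ler1n.
by rewrite (splitr e) lerD.
Qed.

End word_limit_thm.

(** * From low rungs to the limit curve *)

Section recurrence_limit.
Context {R : realType}.
Local Notation tower := (@tower R).

(** The rungs of index less than C(n, k) in the tower of index (n + m, k + m)
    are those obtained by taking m times the right half. The lower bound on n
    makes these m stages negligible for the frequency k / n. *)
Definition low_rung_at (p : R) (m : nat) : set R :=
  [set x | exists n k i, [/\ (m.+1 ^ 2 <= n)%N,
    `|k%:R - p * n%:R| <= n%:R / m.+1%:R, (i < 'C(n, k))%N &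
    in_rung (n + m) (tower (n + m) (k + m))`_i x]].

Definition low_rung_recurrent (p x : R) : Prop := forall m, low_rung_at p m x.

(** Each of the m quotients (k + j) / (n + j) of consecutive binomial
    coefficients is at most rho. *)
Lemma bin_decay (rho : R) n k m : 0 <= rho <= 1 -> (k + m)%:R <= rho * n%:R ->
  'C(n, k)%:R <= rho ^+ m * 'C(n + m, k + m)%:R.
Proof.
move=> /andP[r0 r1]; elim: m => [|m IH] km; first by rewrite !addn0 mul1r.
have km' : (k + m)%:R <= rho * n%:R by apply: le_trans km; rewrite ler_nat addnS.
apply: (le_trans (IH km')); rewrite exprSr -mulrA ler_wpM2l ?exprn_ge0//.
have /(congr1 (fun i => i%:R : R)) := mul_bin_diag (n + m).+1 (k + m).
rewrite !natrM /= !addnS => h.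
have N0 : 0 < (n + m).+1%:R :> R by [].
rewrite -(ler_pM2l N0) h mulrCA mulrA ler_wpM2r//.
rewrite addnS in km; apply: (le_trans km); rewrite ler_wpM2l// ler_nat.
by rewrite leqW// leq_addr.
Qed.

Variable p : R.
Hypotheses (p0 : 0 < p) (p1 : p < 1).

(** Cutting off an initial part of relative length sg moves the argument by at
    most sg, and the correction is governed by the curve at sg, which is small
    as the curve vanishes at 0. *)
Lemma dev_close (s : seq R) (A e w sg t : R) : 0 <= A ->
  (forall u, 0 <= u <= 1 -> `|word_dev s u - A * curve p u| <= A * e) ->
  (forall x y : R, `|x - y| <= sg -> `|curve p x - curve p y| <= w) ->
  0 <= sg <= 1 -> 0 <= t <= 1 ->
  `|word_dev s (sg + (1 - sg) * t) - (1 - t) * word_dev s sg - A * curve p t|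
  <= A * (2 * e + 2 * w).
Proof.
move=> A0 close Mw /andP[sg0 sg1] /andP[t0 t1].
set v := sg + (1 - sg) * t.
have vE : v = t + sg * (1 - t) by rewrite /v; ring.
have st : 0 <= sg * (1 - t) <= sg.
  by rewrite mulr_ge0 ?subr_ge0//= ler_piMr// gerBl.
have st1 : sg * (1 - t) <= 1 - t by rewrite ler_piMl// subr_ge0.
have v01 : 0 <= v <= 1 by rewrite vE; case/andP: st => st0 _; apply/andP; split; lra.
have h1 := close v v01.
have h2 := close sg; rewrite sg0 sg1 in h2; have {}h2 := h2 isT.
have h3 : `|curve p v - curve p t| <= w.
  apply: Mw; rewrite vE addrAC subrr add0r.
  by rewrite ger0_norm; case/andP: st.
have h4 : `|curve p sg| <= w.
  have := Mw sg 0; rewrite subr0 ger0_norm// (curve_out p p0 p1 0) ?lexx//.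
  by rewrite subr0; apply.
have h5 : `|word_dev s sg| <= A * e + A * w.
  have -> : word_dev s sg = (word_dev s sg - A * curve p sg) + A * curve p sg.
    by rewrite subrK.
  apply: (le_trans (ler_normD _ _)); apply: lerD => //.
  by rewrite normrM ger0_norm// ler_wpM2l.
have -> : word_dev s v - (1 - t) * word_dev s sg - A * curve p t =
  (word_dev s v - A * curve p v) + A * (curve p v - curve p t)
  - (1 - t) * word_dev s sg by ring.
have -> : A * (2 * e + 2 * w) = A * e + A * w + (A * e + A * w) by ring.
apply: (le_trans (ler_normB _ _)); apply: lerD.
  apply: (le_trans (ler_normD _ _)); apply: lerD => //.
  by rewrite normrM ger0_norm// ler_wpM2l.
rewrite normrM ger0_norm ?subr_ge0// (le_trans _ h5)// ler_piMl//.
by rewrite gerBl.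
Qed.

(** The curve has sup norm at least 1, so the scale is at least A / 2 and
    normalizing costs a constant factor. *)
Lemma phi_close (g : R -> R) (x : R) l (A e : R) : 0 < A -> 0 < e -> e <= 2^-1 ->
  (forall t, 0 <= t <= 1 -> `|ergodic_dev g x l t - A * curve p t| <= A * e) ->
  forall t, 0 <= t <= 1 ->
  `|ergodic_phi g x l t - curve p t / curve_sup p| <= 4 * e.
Proof.
move=> A0 e0 e1 close t t01.
have m1 := curve_sup_ge1 p p0 p1; set m := curve_sup p in m1 *.
have m0 : 0 < m by apply: lt_le_trans m1.
pose r := sup [set `|ergodic_dev g x l t| | t in `[0, 1]].
have ub : ubound [set `|ergodic_dev g x l t| | t in `[0, 1]] (A * (m + e)).
  move=> _ [u + <-]; rewrite /= in_itv/= => u01.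
  have -> : ergodic_dev g x l u =
    (ergodic_dev g x l u - A * curve p u) + A * curve p u by rewrite subrK.
  apply: (le_trans (ler_normD _ _)); rewrite mulrDr addrC; apply: lerD.
    by rewrite normrM gtr0_norm// ler_pM2l// curve_le_sup.
  exact: close.
have hs : has_sup [set `|ergodic_dev g x l t| | t in `[0, 1]].
  split; last by exists (A * (m + e)).
  by exists `|ergodic_dev g x l 0|, 0 => //; rewrite /= in_itv/= lexx ler01.
have rle : r <= A * (m + e) by apply: ge_sup => //; case: hs.
have rge : A * (m - e) <= r.
  rewrite mulrBr lerBlDr mulrC -ler_pdivlMr//; apply: ge_sup.
    by case: (curve_has_sup p p0 p1).
  move=> _ [u + <-]; rewrite /= in_itv/= => u01.
  rewrite ler_pdivlMr// mulrC -[A in A * _]gtr0_norm// -normrM.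
  have -> : A * curve p u =
    ergodic_dev g x l u - (ergodic_dev g x l u - A * curve p u) by ring.
  apply: (le_trans (ler_normB _ _)); apply: lerD; last exact: close.
  by apply: (ub_le_sup hs.2); exists u => //; rewrite /= in_itv.
have Am : A * m / 2 <= r.
  apply: le_trans rge; rewrite -mulrA ler_pM2l//.
  by move: m1 e1; clear -p0 p1; lra.
have r0 : 0 < r by apply: lt_le_trans Am; rewrite divr_gt0// mulr_gt0.
rewrite /ergodic_phi /ergodic_scale -/r gt_eqF//=.
have -> : ergodic_dev g x l t / r - curve p t / m =
  ((ergodic_dev g x l t - A * curve p t) * m + curve p t * (A * m - r)) / (r * m).
  by field; rewrite !gt_eqF.
rewrite normrM [X in _ * X]gtr0_norm ?invr_gt0 ?mulr_gt0//.
rewrite ler_pdivrMr ?mulr_gt0//.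
apply: (@le_trans _ _ (A * e * m + m * (A * e))).
  apply: (le_trans (ler_normD _ _)); apply: lerD.
    by rewrite normrM (gtr0_norm m0) ler_pM2r//; exact: close.
  rewrite normrM; apply: ler_pM => //; first exact: curve_le_sup.
  rewrite mulrBr in rge; rewrite mulrDr in rle.
  by rewrite ler_norml; move: rge rle; clear -p0 p1; lra.
have -> : A * e * m + m * (A * e) = 4 * e * (A * m / 2) by field.
have -> : 4 * e * (r * m) = 4 * e * r * m by ring.
apply: (@le_trans _ _ (4 * e * r)); first by rewrite ler_pM2l// mulr_gt0.
by rewrite ler_peMr// !mulr_ge0// ltW.
Qed.

(** The orbit segment runs from x up to the top of its tower. *)
Lemma recurrent_close (x e : R) : low_rung_recurrent p x -> 0 < e ->
  exists l, (0 < l)%N /\ orbit_defined x l /\ forall t, 0 <= t <= 1 ->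
  `|ergodic_phi g_half x l t - curve p t / curve_sup p| <= e.
Proof.
move=> rec e0; pose e1 := Num.min (2^-1) (e / 4).
have e10 : 0 < e1 by rewrite lt_min invr_gt0 ltr0n divr_gt0.
have e14 : 0 < e1 / 4 by rewrite divr_gt0.
have [dw dw0 Mw] := curve_unif p p0 p1 (e1 / 4) e14.
have [d d0 [n0 word_lim]] := word_dev_limit p p0 p1 (e1 / 4) e14.
pose rho := (1 + rate p) / 2.
have R1 := rate_lt1 p p0 p1; have [Rp Rq] := rate_ge p.
have rho0 : 0 < rho by rewrite divr_gt0// addr_gt0// rate_gt0.
have rho1 : rho < 1 by rewrite /rho ltr_pdivrMr//; move: R1; clear -p0 p1; lra.
have [m1 hm1] : exists m1, forall m, (m1 <= m)%N -> rho ^+ m <= dw.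
  have : (fun n => rho ^+ n) @ \oo --> (0 : R).
    by apply: cvg_expr; rewrite ger0_norm// ltW.
  move=> /cvgr0Pnorm_le /(_ _ dw0) [m1 _ h]; exists m1 => m /h /= hm.
  by apply: le_trans hm; exact: ler_norm.
pose c := Num.min d (rho - p).
have rp : 0 < rho - p.
  by rewrite subr_gt0 /rho ltr_pdivlMr//; move: R1 Rp; clear -p0 p1; lra.
have c0 : 0 < c by rewrite lt_min d0.
(* Three demands on m: n + m >= n0, the cut rho^m is at most dw, and the
   frequency error 2 / (m + 1) is at most c. *)
pose m := maxn n0 (maxn m1 (Num.truncn (2 / c)).+1).
have [n [k [i [mn kp ik r]]]] := rec m.
have mc : 2 / m.+1%:R <= c.
  rewrite ler_pdivrMr// mulrC -ler_pdivrMr//.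
  apply: le_trans (ltW (truncnS_gt _)) _; rewrite ler_nat.
  by rewrite leqW// /m !leq_max leqnn !orbT.
have n_gt0 : 0 < n%:R :> R by rewrite ltr0n (leq_trans _ mn)// expn_gt0.
have m_n : m%:R <= n%:R / m.+1%:R :> R.
  rewrite ler_pdivlMr// -natrM ler_nat (leq_trans _ mn)// expnS expn1.
  by rewrite leq_mul2r leqnSn orbT.
have two : n%:R / m.+1%:R + n%:R / m.+1%:R <= c * n%:R.
  by rewrite (_ : _ + _ = 2 / m.+1%:R * n%:R) ?ler_pM2r//; ring.
have kpm : `|(k + m)%:R - p * (n + m)%:R| <= d * (n + m)%:R.
  rewrite !natrD.
  have -> : k%:R + m%:R - p * (n%:R + m%:R) =
    (k%:R - p * n%:R) + (1 - p) * m%:R by ring.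
  apply: (le_trans (ler_normD _ _)).
  have hm : `|(1 - p) * m%:R| <= m%:R.
    by rewrite ger0_norm ?mulr_ge0 ?subr_ge0 ?(ltW p1)// ler_piMl// gerBl ltW.
  apply: (le_trans (lerD kp (le_trans hm m_n))); apply: (le_trans two).
  apply: ler_pM; rewrite ?(ltW c0) ?(ltW n_gt0) ?ge_min ?lexx//.
  by rewrite lerDl.
have kmr : (k + m)%:R <= rho * n%:R.
  rewrite natrD; have := le_trans (ler_norm _) kp; rewrite lerBlDr => h1.
  apply: (le_trans (lerD h1 m_n)).
  have : c * n%:R <= (rho - p) * n%:R by rewrite ler_pM2r// ge_min lexx orbT.
  by move: two; set X := n%:R / _; clearbody X c rho; clear -p0 p1; lra.
have nn0 : (n0 <= n + m)%N by rewrite (leq_trans _ (leq_addl _ _))// leq_max leqnn.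
have [A0 close] := word_lim _ _ nn0 kpm.
have decay : 'C(n, k)%:R <= rho ^+ m * 'C(n + m, k + m)%:R :> R.
  by apply: bin_decay => //; rewrite !ltW.
have bnk : (0 < 'C(n, k))%N by apply: leq_ltn_trans ik.
have bE : ('C(n, k) <= 'C(n + m, k + m))%N.
  rewrite -(ler_nat R) (le_trans decay)// ler_piMl// exprn_ile1// ltW//.
have bS : 0 < 'C(n + m, k + m)%:R :> R by rewrite ltr0n (leq_trans bnk).
have iL : (i < 'C(n + m, k + m))%N by apply: leq_trans bE.
have nm0 : (0 < n + m)%N by rewrite addn_gt0 -(ltr_nat R) n_gt0.
pose l := ('C(n + m, k + m) - i)%N.
have lE : 'C(n + m, k + m) = (i + l)%N by rewrite subnKC// ltnW.
have l0 : (0 < l)%N by rewrite subn_gt0.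
exists l; split => //; split; first exact: orbit_defined_rung lE r.
move=> t t01; apply: (@le_trans _ _ (4 * e1)); last first.
  by rewrite mulrC -ler_pdivlMr// ge_min lexx orbT.
apply: (phi_close _ _ _ (amp (n + m) (k + m))) => //.
  by rewrite ge_min lexx.
move=> u u01; rewrite (ergodic_dev_rung _ _ _ _ _ _ nm0 l0 lE r u01).
have -> : e1 = 2 * (e1 / 4) + 2 * (e1 / 4) by field.
apply: dev_close => //; first exact: ltW.
  move=> y z yz; apply: Mw; apply: (le_trans yz); apply: (le_trans _ (hm1 m _)).
    by rewrite ler_pdivrMr// (le_trans _ decay)// ler_nat ltnW.
  by rewrite !leq_max leqnn !orbT.
by rewrite divr_ge0//= ler_pdivrMr// mul1r ler_nat ltnW.
Qed.

Lemma recurrent_cvg (x : R) : low_rung_recurrent p x ->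
  exists l : nat -> nat,
    (forall n, (0 < l n)%N /\ orbit_defined x (l n)) /\
    Linfty01 (fun t => ergodic_phi g_half x (l n) t -
                       limit_curve p t / fine (Linfty01 (limit_curve p)))
      @[n --> \oo] --> 0%E.
Proof.
move=> rec.
have /choice[l hl] : forall n : nat, exists l, (0 < l)%N /\ orbit_defined x l /\
    forall t, 0 <= t <= 1 ->
    `|ergodic_phi g_half x l t - curve p t / curve_sup p| <= n.+1%:R^-1.
  by move=> n; apply: recurrent_close => //; rewrite invr_gt0.
exists l; split; first by move=> n; have [? []] := hl n.
apply: (@squeeze_cvge _ _ _ _ (cst 0%E) _ (fun n => (n.+1%:R^-1)%:E)).
- apply: nearW => n; rewrite Lnorm_ge0/=; apply: Linfty01_le => t t01.
  by rewrite limit_curveE// Linfty01_limit_curve//; apply: (hl n).2.2.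
- exact: cvg_cst.
- by apply: cvg_EFin; [exact: nearW | exact: cvg_harmonic].
Qed.

End recurrence_limit.

(** * Bernoulli digits: independence, weak law, long runs *)

Section bernoulli.
Context {R : realType}.
Variable p : R.
Hypotheses (p0 : 0 < p) (p1 : p < 1).

Let P := @bernoulli_product R p.

Let PP : is_bernoulli_product p P.
Proof. by apply: getPex; apply: bernoulli_product_exists; rewrite p0. Qed.

Definition determined (n : nat) (A : set bin_seq) :=
  forall x y : bin_seq, (forall i, (i < n)%N -> x i = y i) -> A x -> A y.

Definition block (n m : nat) (w : nat -> bool) : set bin_seq :=
  [set x | forall j, (j < m)%N -> x (n + j)%N = w j].

Definition digit (n : nat) (b : bool) : set bin_seq := [set x | x n = b].

Definition set_digit (n : nat) (b : bool) (x : bin_seq) : bin_seq :=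
  fun i => if i == n then b else x i.

Lemma measurable_digit n b : measurable (digit n b).
Proof. by apply: sub_sigma_algebra; exists n, b. Qed.

Lemma measurable_block n m w : measurable (block n m w).
Proof.
elim: m => [|m IH].
  by rewrite (_ : block n 0 w = setT)//; apply/seteqP; split.
rewrite (_ : block n m.+1 w = block n m w `&` digit (n + m) (w m)).
  exact: measurableI (measurable_digit _ _).
apply/seteqP; split => [x h|x [h1 h2] j].
  by split; [move=> j jm; apply: h; exact: leqW|exact: h].
by rewrite ltnS leq_eqVlt => /orP[/eqP ->|/h1].
Qed.

Lemma determined_split n A : determined n.+1 A ->
  A = ([set x | A (set_digit n true x)] `&` digit n true) `|`
      ([set x | A (set_digit n false x)] `&` digit n false).
Proof.
move=> dA; apply/seteqP; split => [x Ax|x [] [/=]].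
  case E : (x n); [left|right]; split => //=; apply: dA Ax => i _;
  by rewrite /set_digit; case: eqP => // ->.
all: move=> + xn; rewrite /digit /= in xn; apply: dA => i _;
  by rewrite /set_digit; case: eqP => // ->.
Qed.

Lemma determined_set_digit n A b : determined n.+1 A ->
  determined n [set x | A (set_digit n b x)].
Proof.
move=> dA x y xy /=; apply: dA => i; rewrite ltnS leq_eqVlt /set_digit.
by case: eqP => //= _; exact: xy.
Qed.

Lemma determined_measurable n A : determined n A -> measurable A.
Proof.
elim: n A => [|n IH] A dA.
  have [[x Ax]|nA] := pselect (A !=set0).
    rewrite (_ : A = setT)//; apply/seteqP; split => // y _.
    by apply: dA Ax.
  rewrite (_ : A = set0)//; apply/seteqP; split => // y Ay.
  by apply: nA; exists y.
rewrite (determined_split _ _ dA); apply: measurableU; apply: measurableI;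
  by [exact: IH (determined_set_digit _ _ _ dA) | exact: measurable_digit].
Qed.

(** Induction on n, splitting A by the last digit on which it may depend; this
    digit joins the block, so the statement has to be proved for all blocks at
    once. *)
Lemma block_independent n A m w : determined n A ->
  P (A `&` block n m w) = (P A * (\prod_(j < m) bernoulli_pmf p (w j))%:E)%E.
Proof.
elim: n A m w => [|n IH] A m w dA.
  have [[x Ax]|nA] := pselect (A !=set0).
    rewrite (_ : A = setT); last by apply/seteqP; split => // y _; apply: dA Ax.
    by rewrite setTI probability_setT mul1e; exact: PP.
  rewrite (_ : A = set0); last first.
    by apply/seteqP; split => // y Ay; apply: nA; exists y.
  by rewrite set0I measure0 mul0e.
pose B b := [set x | A (set_digit n b x)].
have dB b : determined n (B b) by exact: determined_set_digit.
have mB b : measurable (B b) := determined_measurable _ _ (dB b).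
have one b : P (B b `&` digit n b) = (P (B b) * (bernoulli_pmf p b)%:E)%E.
  rewrite (_ : digit n b = block n 1 (fun=> b)).
    by rewrite IH// big_ord1.
  apply/seteqP; split => [x h [|j]//|x h]; first by rewrite addn0.
  by rewrite /digit /= -[n]addn0; apply: h.
have more b : P (B b `&` digit n b `&` block n.+1 m w) =
    (P (B b) * (bernoulli_pmf p b)%:E * (\prod_(j < m) bernoulli_pmf p (w j))%:E)%E.
  rewrite -setIA (_ : digit n b `&` _ =
    block n m.+1 (fun j => if j is i.+1 then w i else b)).
    by rewrite IH// big_ord_recl /= EFinM muleA.
  apply/seteqP; split => [x [h1 h2] [|j] jm|x h].
  - by rewrite addn0.
  - by rewrite addnS -addSn; exact: h2.
  - split; first by rewrite /digit /= -[n]addn0; apply: (h 0%N).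
    by move=> j jm; rewrite addSn -addnS; exact: (h j.+1).
have md b : measurable (B b `&` digit n b).
  by apply: measurableI => //; exact: measurable_digit.
have mm := measurable_block n.+1 m w.
rewrite (determined_split _ _ dA) -!/(B _) setIUl !measureU//; first last.
- by apply/seteqP; split => // x [[[_ +] _] [[_ +] _]]; rewrite /digit /= => ->.
- exact: measurableI.
- exact: measurableI.
- by apply/seteqP; split => // x [[_ +] [_]]; rewrite /digit /= => ->.
pose W : R := \prod_(j < m) bernoulli_pmf p (w j).
transitivity (P (B true) * (bernoulli_pmf p true)%:E * W%:E +
              P (B false) * (bernoulli_pmf p false)%:E * W%:E)%E.
  by congr (_ + _)%E; exact: more.
rewrite -muleDl//.
  by congr (_ * _)%E; congr (_ + _)%E; exact/esym/one.
by apply: ge0_adde_def; rewrite inE mule_ge0// lee_fin bernoulli_pmf_ge0// !ltW.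
Qed.

Definition ones (n : nat) (x : bin_seq) : nat := \sum_(i < n) x i.

(** The expectation of f under the binomial law, obtained by conditioning on the
    last trial, the form in which independence delivers it. *)
Fixpoint binomial_mean (n : nat) (f : nat -> R) : R :=
  if n is m.+1 then
    p * binomial_mean m (fun j => f j.+1) + (1 - p) * binomial_mean m f
  else f 0%N.

Lemma le_binomial_mean n f g : (forall j, f j <= g j) ->
  binomial_mean n f <= binomial_mean n g.
Proof.
elim: n f g => [|n IH] f g fg; first exact: fg.
by apply: lerD; apply: ler_wpM2l; rewrite ?subr_ge0 ?(ltW p0) ?(ltW p1)//;
  exact: IH.
Qed.

Lemma binomial_meanZ n (c : R) f :
  binomial_mean n (fun j => c * f j) = c * binomial_mean n f.
Proof. by elim: n f => [//|n IH] f /=; rewrite !IH; ring. Qed.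

Lemma binomial_mean_sqr n (a : R) :
  binomial_mean n (fun j => (j%:R - a) ^+ 2) =
  n%:R * p * (1 - p) + (n%:R * p - a) ^+ 2.
Proof.
elim: n a => [|n IH] a /=; first by ring.
rewrite (_ : (fun j : nat => (j.+1%:R - a) ^+ 2) =
  (fun j : nat => (j%:R - (a - 1)) ^+ 2)); last first.
  by apply/funext => j; rewrite mulrSr; ring.
by rewrite !IH -natr1; ring.
Qed.

Lemma determined_ones n (Q : nat -> bool) : determined n [set x | Q (ones n x)].
Proof.
move=> x y xy /=; rewrite (_ : ones n x = ones n y)//.
by apply: eq_bigr => i _; rewrite xy.
Qed.

Lemma ones_law n (Q : nat -> bool) :
  P [set x | Q (ones n x)] = (binomial_mean n (fun j => (Q j)%:R))%:E.
Proof.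
elim: n Q => [|n IH] Q.
  have [q|q] := boolP (Q 0%N).
    rewrite (_ : [set x | _] = setT) ?probability_setT /= ?q//.
    by apply/seteqP; split => // x _; rewrite /ones /= big_ord0.
  rewrite (_ : [set x | _] = set0) ?measure0 /= ?(negbTE q)//.
  by apply/seteqP; split => // x; rewrite /ones /= big_ord0 (negbTE q).
have blk b : digit n b = block n 1 (fun=> b).
  apply/seteqP; split => [x h [|j]//|x h]; first by rewrite addn0.
  by rewrite /digit /= -[n]addn0; apply: h.
have one (Q' : nat -> bool) b : P ([set x | Q' (ones n x)] `&` digit n b) =
    (binomial_mean n (fun j => (Q' j)%:R) * bernoulli_pmf p b)%:E.
  by rewrite blk (block_independent n) ?big_ord1 ?IH//; exact: determined_ones.
have m1 (Q' : nat -> bool) b : measurable ([set x | Q' (ones n x)] `&` digit n b).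
  apply: measurableI; last exact: measurable_digit.
  exact: determined_measurable (determined_ones n Q').
rewrite (_ : [set x | _] = ([set x | Q (ones n x).+1] `&` digit n true) `|`
   ([set x | Q (ones n x)] `&` digit n false)).
  have mT := m1 (fun j => Q j.+1) true; have mF := m1 Q false.
  rewrite measureU//; last first.
    by apply/seteqP; split => // x [[_ +] [_]]; rewrite /digit /= => ->.
  transitivity ((binomial_mean n (fun j => (Q j.+1)%:R) * bernoulli_pmf p true)%:E +
     (binomial_mean n (fun j => (Q j)%:R) * bernoulli_pmf p false)%:E)%E.
    by congr (_ + _)%E; exact: one.
  by rewrite -EFinD /= [_ * p]mulrC [X in _ + X]mulrC.
apply/seteqP; split => x /=; rewrite /ones big_ord_recr /= /digit /=.
  by case E : (x n); rewrite ?addn1 ?addn0 => h; [left|right].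
by case=> -[+ ->]; rewrite ?addn1 ?addn0.
Qed.

(** Chebyshev inequality for the number of ones. *)
Lemma weak_law n (a : R) : 0 < a ->
  (P [set x | ~~ (`|(ones n x)%:R - p * n%:R| <= a)%R] <= (n%:R / a ^+ 2)%:E)%E.
Proof.
move=> a0; rewrite (ones_law n (fun j => ~~ (`|j%:R - p * n%:R| <= a))) lee_fin.
have a2 : 0 < a ^+ 2 by rewrite exprn_gt0.
apply: (@le_trans _ _ (binomial_mean n
  (fun j => a ^- 2 * (j%:R - p * n%:R) ^+ 2))).
  apply: le_binomial_mean => j; case: (leP `|j%:R - p * n%:R| a) => /= h.
    by apply: mulr_ge0; rewrite ?invr_ge0 ?sqr_ge0// ltW.
  rewrite mulrC ler_pdivlMr// mul1r -[leRHS]real_normK ?num_real//.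
  by rewrite ler_pXn2r ?nnegrE ?ltW// (lt_trans a0).
rewrite binomial_meanZ binomial_mean_sqr (mulrC p) subrr expr0n addr0.
rewrite mulrC ler_wpM2r ?invr_ge0 ?(ltW a2)// -mulrA ler_piMr//.
by rewrite mulr_ile1 ?(ltW p0) ?(ltW p1) ?subr_ge0 ?(ltW p1)// gerBl ltW.
Qed.

(** The block of m digits 1 followed by a digit 0. The final 0 keeps the coded
    point away from the right end of its dyadic interval. *)
Definition run (m j : nat) : bool := (j < m)%N.

Section long_runs.
Variable m : nat.

(* Consecutive blocks of length m.+1, the first one starting at N. *)
Let start (N j : nat) : nat := (N + j * m.+1)%N.
Let norun (N J : nat) : set bin_seq :=
  [set x | forall j, (j < J)%N -> ~ block (start N j) m.+1 (run m) x].
Let bad (N J : nat) : set bin_seq :=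
  [set x | exists2 j, (j < J)%N &
    ~~ (`|(ones (start N j) x)%:R - p * (start N j)%:R| <= (start N j)%:R / m.+1%:R)].
Let c : R := p ^+ m * (1 - p).

Let c01 : 0 < c <= 1.
Proof.
rewrite mulr_gt0 ?exprn_gt0 ?subr_gt0//=.
by rewrite mulr_ile1 ?exprn_ge0 ?exprn_ile1 ?subr_ge0 ?(ltW p0) ?(ltW p1)// gerBl ltW.
Qed.

Let determined_norun N J : determined (start N J) (norun N J).
Proof.
move=> x y xy nx j jJ h; apply: (nx j jJ) => i im.
rewrite xy; first exact: h.
rewrite /start -addnA ltn_add2l.
apply: (@leq_trans (j.+1 * m.+1)).
  by rewrite mulSn addnC ltn_add2r.
by rewrite leq_mul2r jJ orbT.
Qed.

Let run_weight : \prod_(j < m.+1) bernoulli_pmf p (run m j) = c.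
Proof.
rewrite big_ord_recr /= /run ltnn /=; congr (_ * _).
by under eq_bigr do rewrite ltn_ord; rewrite prodr_const card_ord.
Qed.

Let norunE N J : P (norun N J) = ((1 - c) ^+ J)%:E.
Proof.
elim: J => [|J IH].
  rewrite (_ : norun N 0 = setT) ?probability_setT//.
  by apply/seteqP; split.
have mJ := determined_measurable _ _ (determined_norun N J).
have mb := measurable_block (start N J) m.+1 (run m).
rewrite (_ : norun N J.+1 = norun N J `\` block (start N J) m.+1 (run m)).
  rewrite measureD//; last by rewrite ltey_eq fin_num_measure.
  transitivity (((1 - c) ^+ J)%:E - ((1 - c) ^+ J)%:E * c%:E)%E.
    congr (_ - _)%E; first exact: IH.
    rewrite -IH -run_weight; apply: block_independent; exact: determined_norun.
  by rewrite -EFinM -EFinB exprS; congr EFin; ring.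
apply/seteqP; split => [x h|x [h1 h2] j].
  by split; [move=> j jJ; apply: h; exact: leqW|exact: h].
by rewrite ltnS leq_eqVlt => /orP[/eqP ->|/h1].
Qed.

Let bad_measurable_le N J : (0 < N)%N -> measurable (bad N J) /\
  (P (bad N J) <= (J%:R * m.+1%:R ^+ 2 / N%:R)%:E)%E.
Proof.
move=> N0; elim: J => [|J [mJ IH]].
  rewrite (_ : bad N 0 = set0) ?measure0 ?mul0r//.
  by apply/seteqP; split => // x [].
pose V := [set x | ~~ (`|(ones (start N J) x)%:R - p * (start N J)%:R| <=
  (start N J)%:R / m.+1%:R)].
have mV : measurable V.
  exact: determined_measurable (determined_ones (start N J)
    (fun j => ~~ (`|j%:R - p * (start N J)%:R| <= (start N J)%:R / m.+1%:R))).
rewrite (_ : bad N J.+1 = bad N J `|` V); last first.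
  apply/seteqP; split => [x [j]|x [[j jJ]|]].
  - by rewrite ltnS leq_eqVlt => /orP[/eqP ->|jJ h]; [right|left; exists j].
  - by exists j => //; exact: leqW.
  - by exists J.
split; first exact: measurableU.
apply: (le_trans (measureU2 _ mJ mV)).
rewrite -natr1 2!mulrDl mul1r EFinD; apply: leeD => //.
have s0 : 0 < (start N J)%:R :> R by rewrite ltr0n addn_gt0 N0.
apply: (le_trans (weak_law _ _ _)); first by rewrite divr_gt0.
rewrite lee_fin.
have -> : (start N J)%:R / ((start N J)%:R / m.+1%:R) ^+ 2 =
  m.+1%:R ^+ 2 / (start N J)%:R :> R.
  by field; rewrite !gt_eqF.
apply: ler_wpM2l; first exact: sqr_ge0.
by rewrite lef_pV2 ?posrE ?s0 ?ltr0n// ler_nat leq_addr.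
Qed.

(** A is contained in the union of [norun N J], of measure (1 - c)^J, and of
    [bad N J], of measure at most J (m + 1)^2 / N: J is chosen first, then N. *)
Lemma long_run_frequent (A : set bin_seq) (N0 : nat) : measurable A ->
  (forall x n, A x -> (N0 <= n)%N ->
    `|(ones n x)%:R - p * n%:R| <= n%:R / m.+1%:R -> ~ block n m.+1 (run m) x) ->
  P A = 0%E.
Proof.
move=> mA hA; apply/eqP; rewrite eq_le measure_ge0 andbT.
apply/lee_addgt0Pr => e e0; rewrite add0e.
have [/ltW c0 c1] := andP c01.
have [J hJ] : exists J, (1 - c) ^+ J <= e / 2.
  have : (fun n => (1 - c) ^+ n) @ \oo --> (0 : R).
    apply: cvg_expr; rewrite ger0_norm ?subr_ge0// ltrBlDr ltrDl.
    by case/andP: c01.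
  move=> /cvgr0Pnorm_le /(_ _ (divr_gt0 e0 (ltr0n R 2))) [J _ /(_ J (leqnn J)) /= h].
  by exists J; apply: le_trans h; exact: ler_norm.
pose N := maxn N0 (Num.truncn (J%:R * m.+1%:R ^+ 2 / (e / 2))).+1.
have N_gt0 : (0 < N)%N by rewrite leq_max orbT.
have [mD hD] := bad_measurable_le N J N_gt0.
have mU := determined_measurable _ _ (determined_norun N J).
have sA : A `<=` norun N J `|` bad N J.
  move=> x Ax; have [|nd] := pselect (bad N J x); [by right|left].
  move=> j jJ; apply: hA => //.
    by rewrite (leq_trans (leq_maxl _ _) (leq_addr _ _)).
  by apply: contrapT => h; apply: nd; exists j => //; apply/negP.
apply: (@le_trans _ _ (P (norun N J `|` bad N J))).
  by apply: le_measure => //; rewrite inE//; exact: measurableU.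
apply: (le_trans (measureU2 _ mU mD)).
rewrite (splitr e) EFinD; apply: leeD.
  apply: (@le_trans _ _ ((1 - c) ^+ J)%:E); last by rewrite lee_fin.
  by rewrite -(norunE N J).
apply: (le_trans hD); rewrite lee_fin ler_pdivrMr ?ltr0n// [leRHS]mulrC.
rewrite -ler_pdivrMr ?divr_gt0//.
by apply: (le_trans (ltW (truncnS_gt _))); rewrite ler_nat leq_maxr.
Qed.

End long_runs.
End bernoulli.

(** * Coding points by their digits *)

Section coding.
Context {R : realType}.
Local Notation tower := (@tower R).
Local Arguments Defs.tower : simpl never.

Definition prefix_value (n : nat) (w : bin_seq) : R :=
  series (fun k => (w k)%:R / 2 ^+ k.+1 : R) n.

Lemma prefix_valueS n w :
  prefix_value n.+1 w = prefix_value n w + (w n)%:R * 2 ^- n.+1.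
Proof. by rewrite /prefix_value seriesSr. Qed.

Lemma bin_value_prefix n w :
  prefix_value n w <= bin_value w <= prefix_value n w + 2 ^- n.
Proof.
have cv := @cvg_bin_value R w.
have nd : {homo (series (fun k => (w k)%:R / 2 ^+ k.+1 : R)) :
    a b / (a <= b)%N >-> a <= b}.
  by apply/nondecreasing_series => i _ _; rewrite divr_ge0.
apply/andP; split; first exact: (nondecreasing_cvgn_le nd cv).
apply: limr_le => //; near=> m.
have nm : (n <= m)%N by near: m; exists n.
rewrite -(subnKC nm) -/(prefix_value _ _).
suff : prefix_value (n + (m - n)) w <= prefix_value n w + (2 ^- n - 2 ^- (n + (m - n))).
  by move/le_trans; apply; rewrite lerD2l gerBl invr_ge0 exprn_ge0.
elim: (m - n)%N => [|j IH]; first by rewrite addn0 subrr addr0.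
rewrite addnS prefix_valueS.
have h : 2 ^- (n + j).+1 + 2 ^- (n + j).+1 = 2 ^- (n + j) :> R.
  by rewrite exprS; field; rewrite expf_neq0.
have h0 : 0 <= 2 ^- (n + j).+1 :> R by rewrite invr_ge0 exprn_ge0.
have : (w (n + j)%N)%:R * 2 ^- (n + j).+1 <= 2 ^- (n + j).+1 :> R.
  by rewrite ler_piMl//; case: (w _).
move: IH h; clear; lra.
Unshelve. all: by end_near.
Qed.

Lemma onesS n (w : bin_seq) : ones n.+1 w = (ones n w + w n)%N.
Proof. by rewrite /ones big_ord_recr. Qed.

(** A digit 1 selects the right half of a rung, which keeps its index in the
    next tower; a digit 0 selects the left half, stacked over the [below] rungs
    coming from the neighbouring tower. *)
Lemma prefix_rung n w : (0 < n)%N ->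
  exists2 i, (i < 'C(n, ones n w))%N & (tower n (ones n w))`_i = prefix_value n w.
Proof.
case: n => // n _; elim: n => [|n [i ik iE]].
  exists 0%N; first by rewrite /ones big_ord1; case: (w 0%N).
  rewrite /ones big_ord1 prefix_valueS /prefix_value /series /= big_geq// add0r expr1.
  by case: (w 0%N); rewrite ?mul1r ?mul0r.
rewrite onesS prefix_valueS -iE; case: (w n.+1) => /=.
  exists i; rewrite addn1; last by rewrite towerS_left// mul1r.
  by rewrite below_bin (leq_trans ik)// leq_addr.
exists (below n.+1 (ones n.+1 w) + i)%N; rewrite addn0.
  by rewrite below_bin ltn_add2l.
by rewrite towerS_right// mul0r addr0.
Qed.

Lemma run_rung n k m i w : (0 < n)%N -> (i < 'C(n, k))%N ->
  (tower n k)`_i = prefix_value n w ->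
  (forall j, (j < m)%N -> w (n + j)%N = true) ->
  (i < 'C(n + m, k + m))%N /\
  (tower (n + m) (k + m))`_i = prefix_value (n + m) w.
Proof.
move=> n0 ik iE; elim: m => [|m IH] wm; first by rewrite !addn0.
have [im e] := IH (fun j jm => wm j (leqW jm)).
rewrite !addnS; split; first by rewrite below_bin (leq_trans im)// leq_addr.
by rewrite towerS_left ?addn_gt0 ?n0// e prefix_valueS wm// mul1r.
Qed.

Lemma measurable_low_rung_at p m :
  measurable (low_rung_at p m : set (measurableTypeR R)).
Proof.
pose F n k i : set (measurableTypeR R) :=
  if [&& (m.+1 ^ 2 <= n)%N, `|k%:R - p * n%:R| <= n%:R / m.+1%:R & (i < 'C(n, k))%N]
  then `[(tower (n + m) (k + m))`_i, (tower (n + m) (k + m))`_i + 2 ^- (n + m)[%classic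
  else set0.
rewrite (_ : low_rung_at p m = \bigcup_n \bigcup_k \bigcup_i F n k i).
  do 3 (apply: bigcupT_measurable => ?).
  by rewrite /F; case: ifP => _; [exact: measurable_itv | exact: measurable0].
apply/seteqP; split => [x [n [k [i [h1 h2 h3 h4]]]]|x [n _ [k _ [i _]]]].
  by exists n => //; exists k => //; exists i => //; rewrite /F h1 h2 h3 /= in_itv.
rewrite /F; case: ifP => // /and3P[h1 h2 h3]; rewrite /= in_itv/= => h4.
by exists n, k, i; split.
Qed.

Lemma bin_value_low_rung (p : R) m n (w : bin_seq) : (m.+1 ^ 2 <= n)%N ->
  `|(ones n w)%:R - p * n%:R| <= n%:R / m.+1%:R -> block n m.+1 (run m) w ->
  low_rung_at p m (bin_value w).
Proof.
move=> mn dev bl; have n0 : (0 < n)%N by rewrite (leq_trans _ mn)// expn_gt0.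
have [i ik iE] := prefix_rung n w n0.
have wm j : (j < m)%N -> w (n + j)%N = true.
  by move=> jm; rewrite (bl j (leqW jm)) /run jm.
have [im e] := run_rung _ _ m _ _ n0 ik iE wm.
exists n, (ones n w), i; split => //; rewrite /in_rung e.
have /andP[-> _] := bin_value_prefix (n + m) w.
have /andP[_ h] := bin_value_prefix (n + m).+1 w.
rewrite prefix_valueS (bl m (leqnn _)) /run ltnn mul0r addr0 in h.
apply: (le_lt_trans h); rewrite ltrD2l ltf_pV2 ?posrE ?exprn_gt0//.
by rewrite ltr_eXn2l// ltr1n.
Qed.

Lemma ae_low_rung_recurrent (p : R) : 0 < p < 1 ->
  {ae pascal_mu p, forall x, low_rung_recurrent p x}.
Proof.
move=> /andP[p0 p1].
suff : (pascal_mu p).-negligible (\bigcup_m ~` low_rung_at p m).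
  apply: negligibleS => x /= h; apply: contrapT => nx; apply: h => m.
  by apply: contrapT => hm; apply: nx; exists m.
apply: negligible_bigcup => m.
have mr := measurableC (measurable_low_rung_at p m).
exists (~` low_rung_at p m); split => //.
rewrite /pascal_mu /distribution /pushforward /=.
apply: (@long_run_frequent R p p0 p1 m _ (m.+1 ^ 2)).
  by rewrite -[X in measurable X]setTI; exact: measurable_bin_value.
move=> w n /= nr mn dev bl; apply: nr.
exact: bin_value_low_rung bl.
Qed.

End coding.

Theorem theorem2p3 (R : realType) (p : R) (hp : 0 < p < 1) :
  {ae pascal_mu p, forall x : R, x \in `[0, 1[ ->
    exists l : nat -> nat,
      (forall n, (0 < l n)%N /\ orbit_defined x (l n)) /\
      Linfty01 (fun t => ergodic_phi g_half x (l n) t -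
                         limit_curve p t / fine (Linfty01 (limit_curve p)))
        @[n --> \oo] --> 0%E}.
Proof.
have [p0 p1] := andP hp.
apply: filterS (ae_low_rung_recurrent p hp) => x rec _.
exact: recurrent_cvg.
Qed.
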